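(* There do not exist a commutative $f$-ring $A$ and a surjective lattice homomorphism $\mu\colon \operatorname{Id}^{\mathrm r}_{\mathrm c}A\to \operatorname{Id}^{\ell}_{\mathrm c}G_{\omega_1^{\mathrm{op}}}$.
   Context: An $\ell$-group is a group with a translation-invariant lattice ordering. An $\ell$-ideal of an Abelian $\ell$-group $G$ is a subgroup that is also an order-convex sublattice. $\operatorname{Id}^{\ell}_{\mathrm c}G$ denotes the set of all finitely generated $\ell$-ideals of $G$, ordered by inclusion; it is a distributive lattice with zero. A lattice-ordered ring is a ring (not necessarily unital) with a lattice ordering invariant under additive translations and preserved by multiplication by positive elements; it is an $f$-ring if for all $x,y,z\geq 0$, $x\wedge y=0$ implies $x\wedge yz=x\wedge zy=0$. An $\ell$-ideal of an $f$-ring is a ring ideal that is also an order-convex sublattice; an ideal $I$ is radical if $x^n\in I$ for some $n\ge 1$ implies $x\in I$. For a commutative $f$-ring $A$, $\operatorname{Id}^{\mathrm r}_{\mathrm c}A$ denotes the set of all finitely generated radical $\ell$-ideals of $A$ (those generated, as radical $\ell$-ideals, by finitely many elements), ordered by inclusion; it is a distributive lattice with zero. For a chain $\Lambda$, $\mathbb{Z}\langle\Lambda\rangle$ is the totally ordered Abelian group that is free Abelian on generators $c_\xi$ ($\xi\in\Lambda$), in which an element $x=\sum_{i=1}^n k_ic_{\xi_i}$ with each $k_i\in\mathbb{Z}\setminus\{0\}$ and $\xi_1<\cdots<\xi_n$ in $\Lambda$ is $\geq0$ iff $n=0$ or $k_n>0$. For partially ordered Abelian groups $G$, $H$, the lexicographical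 product $G\times_{\mathrm{lex}}H$ is the group $G\times H$ with positive cone the set of all $(x,y)$ with $x>0$, or $x=0$ and $y\geq0$. $F$ denotes the free Abelian $\ell$-group defined by generators $a$, $b$ subject to the relations $a\geq0$ and $b\geq0$. Set $G_\Lambda=\mathbb{Z}\langle\Lambda\rangle\times_{\mathrm{lex}}F$, an Abelian $\ell$-group. $\omega_1^{\mathrm{op}}$ is the first uncountable ordinal $\omega_1$ with the opposite order. *)

(* Defs.v *)
From HB Require Import structures.
From mathcomp Require Import all_boot all_order all_algebra.
From mathcomp Require Import boolp classical_sets functions cardinality wochoice.
From mathcomp.multinomials Require Import freeg.

Set Implicit Arguments.
Unset Strict Implicit.
Unset Printing Implicit Defensive.

Import Order.TTheory GRing.Theory Num.Theory.

Local Open Scope classical_set_scope.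
Local Open Scope ring_scope.

Reserved Notation "x *# y" (at level 40, left associativity).
Reserved Notation "x /|\ y" (at level 48, left associativity).
Reserved Notation "x \|/ y" (at level 48, left associativity).

HB.mixin Record POrderedZmodule_isPOGroup G of Num.POrderedZmodule G := {
  pog_le_add2l : forall z x y : G, x <= y -> z + x <= z + y
}.

#[short(type="pogroupType")]
HB.structure Definition POGroup :=
  { G of Num.POrderedZmodule G & POrderedZmodule_isPOGroup G }.

HB.mixin Record POGroup_isTotal G of POGroup G := {
  pog_le_total : forall x y : G, (x <= y) || (y <= x)
}.

#[short(type="togroupType")]
HB.structure Definition TOGroup := { G of POGroup G & POGroup_isTotal G }.

(* The meet and join are not inherited from [Order.Lattice]: Hierarchy-Builder
   accepts no new common substructure of [GRing.Zmodule] and [Order.Lattice]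
   below the already declared [Num.RealDomain]. *)
HB.mixin Record POGroup_isLGroup G of POGroup G := {
  lmeet : G -> G -> G;
  ljoin : G -> G -> G;
  le_lmeet : forall x y z : G, (z <= lmeet x y) = (z <= x) && (z <= y);
  ljoin_le : forall x y z : G, (ljoin x y <= z) = (x <= z) && (y <= z)
}.

#[short(type="lgroupType")]
HB.structure Definition LGroup := { G of POGroup G & POGroup_isLGroup G }.

Notation "x /|\ y" := (lmeet x y) : ring_scope.
Notation "x \|/ y" := (ljoin x y) : ring_scope.

HB.factory Record Zmodule_hasPositiveCone G of GRing.Zmodule G := {
  poscone : pred G;
  poscone0 : poscone 0;
  posconeD : forall x y, poscone x -> poscone y -> poscone (x + y);
  poscone_anti : forall x, poscone x -> poscone (- x) -> x = 0
}.

HB.builders Context G of Zmodule_hasPositiveCone G.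
Let le (x y : G) := poscone (y - x).
Let le_refl : reflexive le.
Proof. by move=> x; rewrite /le subrr poscone0. Qed.
Let le_anti : antisymmetric le.
Proof.
move=> x y /andP[xy yx]; apply/eqP; rewrite eq_sym -subr_eq0; apply/eqP.
by apply: poscone_anti => //; rewrite opprB.
Qed.
Let le_trans : transitive le.
Proof.
by move=> y x z xy yz; rewrite /le -(subrKA y z) posconeD.
Qed.
HB.instance Definition _ :=
  Order.Le_isPOrder.Build ring_display G le_refl le_anti le_trans.
Let le_add2l (z x y : G) : x <= y -> z + x <= z + y.
Proof.
by rewrite /Order.le /= /le [z + y]addrC [z + x]addrC opprD addrACA subrr addr0.
Qed.
HB.instance Definition _ := POrderedZmodule_isPOGroup.Build G le_add2l.
HB.end.

Section POGroupTheory.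
Variable G : pogroupType.
Implicit Types x y z : G.

Lemma pog_leD2l z x y : (z + x <= z + y) = (x <= y).
Proof.
apply/idP/idP => [|xy]; last exact: pog_le_add2l.
by move=> /(pog_le_add2l (- z)); rewrite !addKr.
Qed.

Lemma pog_leD2r z x y : (x + z <= y + z) = (x <= y).
Proof. by rewrite ![_ + z]addrC pog_leD2l. Qed.

Lemma pog_leD x y z t : x <= y -> z <= t -> x + z <= y + t.
Proof. by move=> xy zt; rewrite (@le_trans _ _ (y + z)) ?pog_leD2r ?pog_leD2l. Qed.

Lemma pog_subr_ge0 x y : (0 <= y - x) = (x <= y).
Proof. by rewrite -[LHS](pog_leD2r x) subrK add0r. Qed.

Lemma pog_leN2 x y : (- x <= - y) = (y <= x).
Proof. by rewrite -[LHS]pog_subr_ge0 opprK addrC pog_subr_ge0. Qed.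

Lemma pog_addr_ge0 x y : 0 <= x -> 0 <= y -> 0 <= x + y.
Proof. by move=> x0 y0; rewrite -[0]addr0 pog_leD. Qed.

Lemma pog_lerDl x y : (x <= x + y) = (0 <= y).
Proof. by rewrite -{1}[x]addr0 pog_leD2l. Qed.

Lemma pog_lerDr x y : (x <= y + x) = (0 <= y).
Proof. by rewrite addrC pog_lerDl. Qed.

End POGroupTheory.

Section LGroupTheory.
Variable G : lgroupType.
Implicit Types x y z t : G.

Lemma lmeet_lel x y : x /|\ y <= x.
Proof. by have := lexx (x /|\ y); rewrite le_lmeet => /andP[]. Qed.
Lemma lmeet_ler x y : x /|\ y <= y.
Proof. by have := lexx (x /|\ y); rewrite le_lmeet => /andP[]. Qed.
Lemma le_ljoinl x y : x <= x \|/ y.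
Proof. by have := lexx (x \|/ y); rewrite ljoin_le => /andP[]. Qed.
Lemma le_ljoinr x y : y <= x \|/ y.
Proof. by have := lexx (x \|/ y); rewrite ljoin_le => /andP[]. Qed.

Lemma lmeetC x y : x /|\ y = y /|\ x.
Proof. by apply/le_anti; rewrite !le_lmeet !lmeet_lel !lmeet_ler. Qed.

Lemma lmeet_eq z x y : (forall t, (t <= z) = (t <= x) && (t <= y)) -> x /|\ y = z.
Proof.
by move=> H; apply/le_anti; rewrite H lmeet_lel lmeet_ler /= le_lmeet -H lexx.
Qed.

Lemma ljoin_eq z x y : (forall t, (z <= t) = (x <= t) && (y <= t)) -> x \|/ y = z.
Proof.
by move=> H; apply/le_anti; rewrite H le_ljoinl le_ljoinr /= ljoin_le -H lexx.
Qed.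

Lemma lmeetxx x : x /|\ x = x.
Proof. by apply: lmeet_eq => t; rewrite andbb. Qed.

Lemma lmeet_le2 x y z t : x <= z -> y <= t -> x /|\ y <= z /|\ t.
Proof.
by move=> xz yt; rewrite le_lmeet (le_trans (lmeet_lel _ _) xz)
  (le_trans (lmeet_ler _ _) yt).
Qed.

Lemma lmeet_l x y : x <= y -> x /|\ y = x.
Proof.
move=> xy; apply: lmeet_eq => t; case: (boolP (t <= x)) => //= tx.
by rewrite (le_trans tx xy).
Qed.

Lemma lmeetDl z x y : z + (x /|\ y) = (z + x) /|\ (z + y).
Proof.
apply/esym/lmeet_eq => t; rewrite -(pog_leD2l (- z)) addKr le_lmeet.
by rewrite -(pog_leD2l z) addNKr -[in X in _ && X](pog_leD2l z) addNKr.
Qed.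

Lemma ljoinDl z x y : z + (x \|/ y) = (z + x) \|/ (z + y).
Proof.
apply/esym/ljoin_eq => t; rewrite -(pog_leD2l (- z)) addKr ljoin_le.
by rewrite -(pog_leD2l z) addNKr -[in X in _ && X](pog_leD2l z) addNKr.
Qed.

Lemma lmeetDr z x y : (x /|\ y) + z = (x + z) /|\ (y + z).
Proof. by rewrite ![_ + z]addrC lmeetDl. Qed.

Lemma lmeetN x y : - (x /|\ y) = (- x) \|/ (- y).
Proof.
apply/esym/ljoin_eq => t; rewrite -[t]opprK !pog_leN2; exact: le_lmeet.
Qed.

Lemma unperforated2 x : 0 <= x + x -> 0 <= x.
Proof.
move=> x2; set m := x /|\ 0.
have mm : m + m = m.
  rewrite {1}/m lmeetDr add0r /m lmeetDl addr0.
  apply: lmeet_eq => t; rewrite !le_lmeet.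
  case tx : (t <= x); case t0 : (t <= 0); rewrite /= ?andbT ?andbF //.
  by rewrite (le_trans t0 x2).
have m0 : m = 0 by apply: (addIr m); rewrite mm add0r.
by rewrite -m0 lmeet_lel.
Qed.

Definition labs x := x \|/ (- x).

Lemma le_labs x : x <= labs x. Proof. exact: le_ljoinl. Qed.
Lemma leN_labs x : - x <= labs x. Proof. exact: le_ljoinr. Qed.
Lemma lerN_labs x : - labs x <= x.
Proof. by rewrite -[leRHS]opprK pog_leN2 leN_labs. Qed.
Lemma labs_le x y : (labs x <= y) = (x <= y) && (- x <= y).
Proof. exact: ljoin_le. Qed.
Lemma labs_ge0 x : 0 <= labs x.
Proof.
by apply: unperforated2; rewrite -(subrr x); apply: pog_leD;
  [exact: le_labs|exact: leN_labs].
Qed.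
Lemma labsB_ge0 x : 0 <= labs x - x.
Proof. by rewrite pog_subr_ge0 le_labs. Qed.
Lemma labsD_ge0 x : 0 <= labs x + x.
Proof. by have := leN_labs x; rewrite -pog_subr_ge0 opprK. Qed.
Lemma labsN x : labs (- x) = labs x.
Proof. by apply: ljoin_eq => t; rewrite labs_le opprK andbC. Qed.
Lemma labsD x y : labs (x + y) <= labs x + labs y.
Proof. by rewrite labs_le opprD !pog_leD ?le_labs ?leN_labs. Qed.
Lemma labs_id x : 0 <= x -> labs x = x.
Proof.
move=> x0; apply: ljoin_eq => t; case: (boolP (x <= t)) => //= xt.
by rewrite (@le_trans _ _ 0) ?(le_trans x0 xt)// -oppr0 pog_leN2.
Qed.
Lemma labs_between x y z : x <= y -> y <= z -> labs y <= labs x + labs z.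
Proof.
move=> xy yz; rewrite labs_le (le_trans yz) /=; last first.
  by rewrite (le_trans (le_labs z))// pog_lerDr labs_ge0.
rewrite (@le_trans _ _ (- x)) ?pog_leN2//.
by rewrite (le_trans (leN_labs x))// pog_lerDl labs_ge0.
Qed.
Lemma labs_meet x y : labs (x /|\ y) <= labs x + labs y.
Proof.
rewrite labs_le (le_trans (lmeet_lel x y)) /=; last first.
  by rewrite (le_trans (le_labs x))// pog_lerDl labs_ge0.
rewrite lmeetN ljoin_le (le_trans (leN_labs x)) ?pog_lerDl ?labs_ge0//=.
by rewrite (le_trans (leN_labs y)) ?pog_lerDr ?labs_ge0.
Qed.
Lemma labs_join x y : labs (x \|/ y) <= labs x + labs y.
Proof.
have -> : x \|/ y = - ((- x) /|\ (- y)) by rewrite lmeetN !opprK.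
by rewrite labsN -(labsN x) -(labsN y) labs_meet.
Qed.

Lemma lmeet_ge0 x y : 0 <= x -> 0 <= y -> 0 <= x /|\ y.
Proof. by move=> x0 y0; rewrite le_lmeet x0. Qed.

Lemma lmeet_subadd x y z : 0 <= x -> 0 <= y -> 0 <= z ->
  (x + y) /|\ z <= x /|\ z + y /|\ z.
Proof.
move=> x0 y0 z0; rewrite lmeetDr !lmeetDl !le_lmeet lmeet_lel /=.
rewrite !(le_trans (lmeet_ler (x + y) z)) ?pog_lerDl ?pog_lerDr//.
Qed.

Lemma lmeet_add_join x y : x /|\ y + x \|/ y = x + y.
Proof.
rewrite -[x /|\ y]opprK lmeetN; apply/eqP.
rewrite addrC subr_eq ljoinDl; apply/eqP/ljoin_eq => t.
by rewrite addrAC subrr add0r addrK ljoin_le andbC.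
Qed.

End LGroupTheory.

HB.mixin Record LGroup_isLRing A of LGroup A := {
  lmul : A -> A -> A;
  lmulA : associative lmul;
  lmulDl : left_distributive lmul +%R;
  lmulDr : right_distributive lmul +%R;
  ler_lmul2l : forall z x y : A, 0 <= z -> x <= y -> lmul z x <= lmul z y;
  ler_lmul2r : forall z x y : A, 0 <= z -> x <= y -> lmul x z <= lmul y z
}.

#[short(type="lringType")]
HB.structure Definition LRing := { A of LGroup A & LGroup_isLRing A }.

Notation "x *# y" := (lmul x y) : ring_scope.

HB.mixin Record LRing_isFRing A of LRing A := {
  fring_disjoint : forall x y z : A, 0 <= x -> 0 <= y -> 0 <= z ->
    x /|\ y = 0 -> x /|\ (y *# z) = 0 /\ x /|\ (z *# y) = 0
}.

#[short(type="fringType")]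
HB.structure Definition FRing := { A of LRing A & LRing_isFRing A }.

HB.mixin Record FRing_isCommutative A of FRing A := {
  lmulC : commutative (@lmul A)
}.

#[short(type="comFringType")]
HB.structure Definition ComFRing := { A of FRing A & FRing_isCommutative A }.

(* [lpow x n] is x^n for n >= 1; there is no unit, so the value at n = 0 is
   meaningless and every use is guarded by 0 < n. *)
Definition lpow (A : lringType) (x : A) (n : nat) : A := iter n.-1 (lmul x) x.

Section LRingTheory.
Variable A : lringType.
Implicit Types x y z : A.

Lemma lmul0 x : x *# 0 = 0.
Proof. by apply: (addIr (x *# 0)); rewrite -lmulDr !add0r. Qed.
Lemma l0mul x : 0 *# x = 0.
Proof. by apply: (addIr (0 *# x)); rewrite -lmulDl !add0r. Qed.
Lemma lmulN x y : x *# (- y) = - (x *# y).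
Proof. by apply/eqP; rewrite -addr_eq0 -lmulDr addNr lmul0. Qed.
Lemma lNmul x y : (- x) *# y = - (x *# y).
Proof. by apply/eqP; rewrite -addr_eq0 -lmulDl addNr l0mul. Qed.
Lemma lmul_ge0 x y : 0 <= x -> 0 <= y -> 0 <= x *# y.
Proof. by move=> x0 y0; rewrite -(lmul0 x) ler_lmul2l. Qed.

Lemma labsM_le x y : labs (x *# y) <= labs x *# labs y.
Proof.
have key u : u *# y <= labs u *# labs y.
  rewrite -pog_subr_ge0; apply: unperforated2.
  have h1 := lmul_ge0 (labsB_ge0 u) (labsD_ge0 y).
  have h2 := lmul_ge0 (labsD_ge0 u) (labsB_ge0 y).
  have := pog_addr_ge0 h1 h2; congr (_ <= _).
  rewrite !lmulDl !lmulDr !lmulN !lNmul ?opprK.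
  set a := labs u *# labs y; set b := labs u *# y; set c := u *# labs y.
  set d := u *# y.
  rewrite [- c - d]addrC [a + b + _]addrACA [c - d]addrC [a - b + _]addrACA.
  by rewrite [LHS]addrACA [b - c + _]addrACA subrr addNr addr0 addr0.
rewrite labs_le key /= -lNmul -(labsN x); exact: key.
Qed.

End LRingTheory.

Section ComFRingTheory.
Variable A : comFringType.
Implicit Types x y z a b c d : A.

Let lpos x := x \|/ 0.
Let lneg x := (- x) \|/ 0.

Let lpos_ge0 x : 0 <= lpos x. Proof. exact: le_ljoinr. Qed.
Let lneg_ge0 x : 0 <= lneg x. Proof. exact: le_ljoinr. Qed.

Let lneg_pos x : lneg x = lpos x - x.
Proof.
rewrite [RHS]addrC ljoinDl addNr addr0; apply: ljoin_eq => t.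
by rewrite ljoin_le andbC.
Qed.

Let lposB x : lpos x - lneg x = x.
Proof. by rewrite lneg_pos opprB addrC subrK. Qed.

Let lpos_disj x : lpos x /|\ lneg x = 0.
Proof.
rewrite lneg_pos -{1}[lpos x]addr0 -lmeetDl -[0 /|\ _]opprK lmeetN oppr0 opprK.
apply/eqP; rewrite subr_eq0; apply/eqP/esym/ljoin_eq => t.
by rewrite ljoin_le andbC.
Qed.

Let labs_posneg x : labs x = lpos x + lneg x.
Proof.
rewrite -lmeet_add_join lpos_disj add0r; apply: ljoin_eq => t.
rewrite !ljoin_le; case xt : (x <= t) => //=; case nxt : (- x <= t) => /=;
  rewrite ?andbF //.
by rewrite (le_trans (labs_ge0 x)) // labs_le xt.
Qed.

Let disj_mul a b c d : 0 <= a -> 0 <= b -> 0 <= c -> 0 <= d ->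
  a /|\ b = 0 -> (c *# a) /|\ (d *# b) = 0.
Proof.
move=> a0 b0 c0 d0 /(fring_disjoint _ _ _ a0 b0 d0)[_ ab].
rewrite lmeetC in ab.
have [_ <-] := fring_disjoint _ _ _ (lmul_ge0 d0 b0) a0 c0 ab.
exact: lmeetC.
Qed.

Let disj_add a b c : 0 <= a -> 0 <= b -> 0 <= c ->
  a /|\ c = 0 -> b /|\ c = 0 -> (a + b) /|\ c = 0.
Proof.
move=> a0 b0 c0 ac bc; apply/le_anti.
rewrite (le_trans (lmeet_subadd a0 b0 c0)) ?ac ?bc ?addr0//=.
by rewrite lmeet_ge0// pog_addr_ge0.
Qed.

Lemma labsM x y : labs (x *# y) = labs x *# labs y.
Proof.
apply/le_anti; rewrite labsM_le /=.
set p := lpos x *# lpos y + lneg x *# lneg y.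
set n := lpos x *# lneg y + lneg x *# lpos y.
have p0 : 0 <= p by rewrite pog_addr_ge0 ?lmul_ge0 ?lpos_ge0 ?lneg_ge0.
have n0 : 0 <= n by rewrite pog_addr_ge0 ?lmul_ge0 ?lpos_ge0 ?lneg_ge0.
have xyE : x *# y = p - n.
  rewrite -{1}(lposB x) -{1}(lposB y) !lmulDl !lmulDr !lmulN !lNmul opprK.
  by rewrite /p /n opprD [- _ + _ *# _]addrC addrACA.
have axyE : labs x *# labs y = p + n.
  rewrite !labs_posneg !lmulDl !lmulDr /p /n.
  by rewrite [lneg x *# lpos y + _]addrC addrACA.
have dxN : lneg x /|\ lpos x = 0 by rewrite lmeetC.
have dyN : lneg y /|\ lpos y = 0 by rewrite lmeetC.
have disjr u v c d : 0 <= u -> 0 <= v -> 0 <= c -> 0 <= d ->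
    u /|\ v = 0 -> (u *# c) /|\ (v *# d) = 0.
  by move=> *; rewrite [u *# c]lmulC [v *# d]lmulC; apply: disj_mul.
have pn : p /|\ n = 0.
  apply: disj_add; rewrite ?lmul_ge0 ?lpos_ge0 ?lneg_ge0//;
    rewrite lmeetC; apply: disj_add; rewrite ?lmul_ge0 ?lpos_ge0 ?lneg_ge0//.
  - exact: disj_mul.
  - exact: disjr.
  - exact: disjr.
  - exact: disj_mul.
rewrite axyE -lmeet_add_join pn add0r xyE ljoin_le.
rewrite -[leLHS]addr0 -[X in _ + X]oppr0 -pn lmeetN ljoinDl subrr.
rewrite ljoin_le labs_ge0 le_labs /=.
rewrite -[leLHS]addr0 -[X in _ + X]oppr0 -pn lmeetN ljoinDl subrr.
by rewrite ljoin_le labs_ge0 -opprB leN_labs.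
Qed.

Lemma lmul_disj0 a b : 0 <= a -> 0 <= b -> a /|\ b = 0 -> a *# b = 0.
Proof.
move=> a0 b0 ab; rewrite -[LHS]lmeetxx [X in X /|\ _]lmulC.
exact: disj_mul.
Qed.

Lemma lmul_meet_split a b : 0 <= a -> 0 <= b ->
  a *# b = (a /|\ b) *# b + (a - a /|\ b) *# (a /|\ b).
Proof.
move=> a0 b0; set d := a /|\ b.
have -> : (a - d) *# d = (a - d) *# b.
  apply/eqP; rewrite -subr_eq0 -lmulN -lmulDr -[d - b]opprB lmulN oppr_eq0.
  rewrite lmul_disj0 ?pog_subr_ge0 ?lmeet_lel ?lmeet_ler//.
  by rewrite -lmeetDr subrr.
by rewrite -lmulDl [d + _]addrC subrK.
Qed.

Lemma lpowS x n : lpow x n.+2 = x *# lpow x n.+1.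
Proof. by []. Qed.

Lemma lpowM x y n : lpow (x *# y) n.+1 = lpow x n.+1 *# lpow y n.+1.
Proof.
elim: n => // n IH; rewrite !lpowS IH -!lmulA; congr (_ *# _).
by rewrite lmulA [y *# _]lmulC -lmulA.
Qed.

Lemma lpow_labs x n : lpow (labs x) n.+1 = labs (lpow x n.+1).
Proof. by elim: n => // n IH; rewrite !lpowS IH labsM. Qed.

End ComFRingTheory.

Fact ideal_display : Order.disp_t. Proof. exact: Order.Disp tt tt. Qed.

Section FinitelyGenerated.
Variables (T : choiceType) (C : set T -> Prop).

Definition finitely_generated (I : set T) : Prop :=
  exists s : seq T, I = smallest C [set` s].

Record fgclosed := FGClosed {
  fgset :> set T;
  _ : `[< finitely_generated fgset >] }.

HB.instance Definition _ := [isSub for fgset].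
HB.instance Definition _ := [Choice of fgclosed by <:].
HB.instance Definition _ :=
  [SubChoice_isSubPOrder of fgclosed by <: with ideal_display].

Lemma fgclosed_le (I J : fgclosed) : (I <= J)%O <-> (I : set T) `<=` J.
Proof. by rewrite -subsetEset. Qed.

Hypothesis C_bigcap : forall F : set (set T),
  (forall I, F I -> C I) -> C (\bigcap_(I in F) I).
Hypothesis C_meet : forall I J : set T,
  finitely_generated I -> finitely_generated J -> finitely_generated (I `&` J).

Lemma C_smallest S : C (smallest C S).
Proof. by apply: C_bigcap => I []. Qed.

Lemma fgclosed_join_subproof (I J : fgclosed) :
  `[< finitely_generated (smallest C ((I : set T) `|` J)) >].
Proof.
case: I J => [I /= /asboolP[s ->]] [J /= /asboolP[t ->]].
apply/asboolP; exists (s ++ t); apply/seteqP; split.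
  apply: smallest_sub; first exact: C_smallest.
  rewrite subUset; split; apply: sub_smallest2r (C_smallest _) _ => x /= xs;
    by rewrite mem_cat xs ?orbT.
apply: smallest_sub; first exact: C_smallest.
move=> x /=; rewrite mem_cat => xst; apply: sub_gen_smallest.
by case/orP: xst => xs; [left|right]; apply: sub_gen_smallest.
Qed.

Lemma fgclosed_meet_subproof (I J : fgclosed) :
  `[< finitely_generated ((I : set T) `&` J) >].
Proof.
by case: I J => [I /= /asboolP fI] [J /= /asboolP fJ]; apply/asboolP/C_meet.
Qed.

Definition fgclosed_meet (I J : fgclosed) := FGClosed (fgclosed_meet_subproof I J).
Definition fgclosed_join (I J : fgclosed) := FGClosed (fgclosed_join_subproof I J).

Lemma fgclosed_meetP (K I J : fgclosed) :
  (K <= fgclosed_meet I J)%O = (K <= I)%O && (K <= J)%O.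
Proof.
apply/idP/andP => [/fgclosed_le|[/fgclosed_le KI /fgclosed_le KJ]].
  by rewrite subsetI => -[KI KJ]; split; apply/fgclosed_le.
by apply/fgclosed_le; rewrite subsetI.
Qed.

Lemma fgclosed_C (I : fgclosed) : C I.
Proof. by case: I => I /= /asboolP[s ->]; exact: C_smallest. Qed.

Lemma fgclosed_joinP (I J K : fgclosed) :
  (fgclosed_join I J <= K)%O = (I <= K)%O && (J <= K)%O.
Proof.
apply/idP/andP => [/fgclosed_le IJK|[/fgclosed_le KI /fgclosed_le KJ]].
  have : (I : set T) `|` J `<=` K.
    by apply: subset_trans IJK; apply: sub_smallest.
  by rewrite subUset => -[IK JK]; split; apply/fgclosed_le.
apply/fgclosed_le; apply: smallest_sub; first exact: fgclosed_C.
by rewrite subUset.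
Qed.

End FinitelyGenerated.

Definition is_lideal (G : lgroupType) (I : set G) : Prop :=
  [/\ I 0 /\ (forall x y, I x -> I y -> I (x - y)),
      (forall x y, I x -> I y -> I (x /|\ y) /\ I (x \|/ y))
    & (forall x y z, I x -> I z -> x <= y -> y <= z -> I y)].

Definition is_ring_lideal (A : fringType) (I : set A) : Prop :=
  is_lideal I /\ (forall a x, I x -> I (a *# x) /\ I (x *# a)).

Definition is_radical_lideal (A : fringType) (I : set A) : Prop :=
  is_ring_lideal I /\ (forall x n, (0 < n)%N -> I (lpow x n) -> I x).

Definition Idlc (G : lgroupType) : Type := fgclosed (@is_lideal G).
Definition Idrc (A : comFringType) : Type := fgclosed (@is_radical_lideal A).

Section LIdealTheory.
Variable G : lgroupType.
Implicit Types (I J : set G) (x y z : G).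

Lemma is_lideal_bigcap (F : set (set G)) :
  (forall I, F I -> is_lideal I) -> is_lideal (\bigcap_(I in F) I).
Proof.
move=> FI; split; first split.
- by move=> I /FI[[]].
- by move=> x y Ix Iy I IF; have [[_ IB] _ _] := FI _ IF; apply: IB; [apply: Ix|apply: Iy].
- move=> x y Ix Iy; split=> I IF; have [_ IL _] := FI _ IF;
    by case: (IL x y (Ix _ IF) (Iy _ IF)).
- move=> x y z Ix Iz xy yz I IF; have [_ _ IC] := FI _ IF.
  exact: (IC x y z (Ix _ IF) (Iz _ IF)).
Qed.

Lemma is_lidealN I x : is_lideal I -> I x -> I (- x).
Proof. by move=> [[I0 IB] _ _] Ix; rewrite -sub0r; apply: IB. Qed.

Lemma is_lidealD I x y : is_lideal I -> I x -> I y -> I (x + y).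
Proof.
move=> II Ix Iy; rewrite -[y]opprK; case: (II) => [[_ IB] _ _].
by apply: IB => //; apply: is_lidealN.
Qed.

Lemma is_lideal_abs I x : is_lideal I -> I x -> I (labs x).
Proof.
by move=> II Ix; case: (II) => _ IL _; case: (IL x (- x) Ix (is_lidealN II Ix)).
Qed.

Lemma is_lideal_ge0 I x y : is_lideal I -> I y -> 0 <= x -> x <= y -> I x.
Proof. by move=> [[I0 _] _ IC] Iy x0 xy; apply: IC I0 Iy x0 xy. Qed.

Lemma is_lideal_of_abs I x : is_lideal I -> I (labs x) -> I x.
Proof.
move=> II Ix; case: (II) => _ _ IC.
by apply: (IC _ x _ (is_lidealN II Ix) Ix); rewrite ?le_labs ?lerN_labs.
Qed.

Lemma is_lideal_labs I : I 0 ->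
  (forall x y z, I x -> I y -> labs z <= labs x + labs y -> I z) -> is_lideal I.
Proof.
move=> I0 IC; split; first split=> //.
- by move=> x y Ix Iy; apply: (IC x y) => //; rewrite -(labsN y) labsD.
- move=> x y Ix Iy; split; apply: (IC x y) => //; [exact: labs_meet|exact: labs_join].
- move=> x y z Ix Iz xy yz; apply: (IC x z) => //; exact: labs_between.
Qed.

Definition lmeet_polar I (P : set G) : set G :=
  [set x | forall t, P t -> I (labs x /|\ labs t)].

Lemma is_lideal_polar I P : is_lideal I -> is_lideal (lmeet_polar I P).
Proof.
move=> II; apply: is_lideal_labs => [t _|x y z Ix Iy zxy t Pt].
  have -> : labs (0 : G) = 0 by rewrite labs_id.
  by rewrite lmeet_l ?labs_ge0//; case: II => -[].
apply: (is_lideal_ge0 II (is_lidealD II (Ix t Pt) (Iy t Pt))).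
  by rewrite lmeet_ge0 ?labs_ge0.
apply: (le_trans _ (lmeet_subadd _ _ _)); rewrite ?labs_ge0//.
exact: lmeet_le2.
Qed.

Lemma lideal_meet_fg I J :
  finitely_generated (@is_lideal G) I -> finitely_generated (@is_lideal G) J ->
  finitely_generated (@is_lideal G) (I `&` J).
Proof.
move=> [s Is] [t Jt].
have II : is_lideal I by rewrite Is; apply: C_smallest; exact: is_lideal_bigcap.
have IJ : is_lideal J by rewrite Jt; apply: C_smallest; exact: is_lideal_bigcap.
exists [seq labs x /|\ labs y | x <- s, y <- t].
set K := smallest _ _.
have IK : is_lideal K by apply: C_smallest; exact: is_lideal_bigcap.
apply/seteqP; split; last first.
  have IIJ : is_lideal (I `&` J).
    have -> : I `&` J = \bigcap_(L in [set I; J]) L by rewrite bigcap_setU !bigcap_set1.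
    by apply: is_lideal_bigcap => L [] ->.
  apply: smallest_sub => // _ /= /allpairsP[[x y] /= [xs yt ->]].
  have Ix : I x by rewrite Is; apply: sub_gen_smallest.
  have Jy : J y by rewrite Jt; apply: sub_gen_smallest.
  by split; [apply: (is_lideal_ge0 II (is_lideal_abs II Ix))
            |apply: (is_lideal_ge0 IJ (is_lideal_abs IJ Jy))];
    rewrite ?lmeet_ge0 ?labs_ge0 ?lmeet_lel ?lmeet_ler.
have sI : I `<=` lmeet_polar K [set` t].
  rewrite Is; apply: smallest_sub; first exact: is_lideal_polar.
  move=> x /= xs y /= yt; apply: sub_gen_smallest => /=.
  by apply/allpairsP; exists (x, y).
have tJ : J `<=` lmeet_polar K I.
  rewrite Jt; apply: smallest_sub; first exact: is_lideal_polar.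
  by move=> y /= yt x Ix; rewrite lmeetC; apply: sI.
move=> x [Ix Jx]; apply: (is_lideal_of_abs IK).
by rewrite -[labs x]lmeetxx; apply: tJ.
Qed.

End LIdealTheory.

Section RadicalIdealTheory.
Variable A : comFringType.
Implicit Types (I J : set A) (x y z : A).

Lemma is_radical_lideal_bigcap (F : set (set A)) :
  (forall I, F I -> is_radical_lideal I) ->
  is_radical_lideal (\bigcap_(I in F) I).
Proof.
move=> FI; split; first split.
- by apply: is_lideal_bigcap => I /FI[[]].
- move=> a x Ix; split=> I IF; have [[_ IM] _] := FI _ IF;
    by case: (IM a x (Ix _ IF)).
- move=> x n n0 Ix I IF; have [_ IR] := FI _ IF.
  exact: IR n0 (Ix _ IF).
Qed.

Definition lmul_polar I (P : set A) : set A :=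
  [set x | forall t, P t -> I (labs x *# labs t)].

Lemma is_radical_lideal_polar I P :
  is_radical_lideal I -> is_radical_lideal (lmul_polar I P).
Proof.
move=> [[II IM] IR]; split; first split.
- apply: is_lideal_labs => [t _|x y z Ix Iy zxy t Pt].
    have -> : labs (0 : A) = 0 by rewrite labs_id.
    by rewrite l0mul; case: II => -[].
  apply: (is_lideal_ge0 II (is_lidealD II (Ix t Pt) (Iy t Pt))).
    by rewrite lmul_ge0 ?labs_ge0.
  by rewrite -lmulDl ler_lmul2r ?labs_ge0.
- move=> a x Ix; rewrite [x *# a]lmulC; suff H : lmul_polar I P (a *# x) by [].
  by move=> t Pt; rewrite labsM -lmulA; case: (IM (labs a) _ (Ix t Pt)).
- move=> x [//|n] _ Ix t Pt; apply: (IR _ n.+1) => //.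
  have := Ix t Pt; rewrite lpowM -lpow_labs; case: n {Ix} => [//|n] Ix.
  rewrite [lpow (labs t) _]lpowS lmulA.
  by case: (IM (lpow (labs t) n.+1) _ Ix).
Qed.

Lemma radical_lideal_meet_fg I J :
  finitely_generated (@is_radical_lideal A) I ->
  finitely_generated (@is_radical_lideal A) J ->
  finitely_generated (@is_radical_lideal A) (I `&` J).
Proof.
move=> [s Is] [t Jt].
have RI : is_radical_lideal I.
  by rewrite Is; apply: C_smallest; exact: is_radical_lideal_bigcap.
have RJ : is_radical_lideal J.
  by rewrite Jt; apply: C_smallest; exact: is_radical_lideal_bigcap.
have [[II _] _] := RI; have [[IJ _] _] := RJ.
exists [seq labs x /|\ labs y | x <- s, y <- t].
set K := smallest _ _.
have RK : is_radical_lideal K.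
  by apply: C_smallest; exact: is_radical_lideal_bigcap.
have [[IK KM] KR] := RK.
apply/seteqP; split; last first.
  have IIJ : is_radical_lideal (I `&` J).
    have -> : I `&` J = \bigcap_(L in [set I; J]) L
      by rewrite bigcap_setU !bigcap_set1.
    by apply: is_radical_lideal_bigcap => L [] ->.
  apply: smallest_sub => // _ /= /allpairsP[[x y] /= [xs yt ->]].
  have Ix : I x by rewrite Is; apply: sub_gen_smallest.
  have Jy : J y by rewrite Jt; apply: sub_gen_smallest.
  by split; [apply: (is_lideal_ge0 II (is_lideal_abs II Ix))
            |apply: (is_lideal_ge0 IJ (is_lideal_abs IJ Jy))];
    rewrite ?lmeet_ge0 ?labs_ge0 ?lmeet_lel ?lmeet_ler.
have sI : I `<=` lmul_polar K [set` t].
  rewrite Is; apply: smallest_sub; first exact: is_radical_lideal_polar.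
  move=> x /= xs y /= yt.
  have Kxy : K (labs x /|\ labs y).
    by apply: sub_gen_smallest => /=; apply/allpairsP; exists (x, y).
  rewrite lmul_meet_split ?labs_ge0//; apply: (is_lidealD IK).
    by case: (KM (labs y) _ Kxy).
  by case: (KM (labs x - labs x /|\ labs y) _ Kxy).
have tJ : J `<=` lmul_polar K I.
  rewrite Jt; apply: smallest_sub; first exact: is_radical_lideal_polar.
  by move=> y /= yt x Ix; rewrite lmulC; apply: (sI x Ix).
move=> x [Ix Jx]; apply: (is_lideal_of_abs IK).
by apply: (KR _ 2) => //; apply: (tJ x Jx).
Qed.

End RadicalIdealTheory.

HB.instance Definition _ (G : lgroupType) :=
  Order.POrder.copy (Idlc G) (fgclosed (@is_lideal G)).
HB.instance Definition _ (G : lgroupType) :=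
  @Order.POrder_MeetJoin_isLattice.Build ideal_display (Idlc G)
    (fgclosed_meet (@lideal_meet_fg G))
    (fgclosed_join (@is_lideal_bigcap G))
    (fgclosed_meetP (@lideal_meet_fg G))
    (fgclosed_joinP (@is_lideal_bigcap G)).
HB.instance Definition _ (A : comFringType) :=
  Order.POrder.copy (Idrc A) (fgclosed (@is_radical_lideal A)).
HB.instance Definition _ (A : comFringType) :=
  @Order.POrder_MeetJoin_isLattice.Build ideal_display (Idrc A)
    (fgclosed_meet (@radical_lideal_meet_fg A))
    (fgclosed_join (@is_radical_lideal_bigcap A))
    (fgclosed_meetP (@radical_lideal_meet_fg A))
    (fgclosed_joinP (@is_radical_lideal_bigcap A)).

Definition lexprod (G H : Type) : Type := (G * H)%type.
Notation "G \xlex H" := (lexprod G H) (at level 40, left associativity).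

HB.instance Definition _ (G H : pogroupType) := GRing.Zmodule.on (G \xlex H).

Section LexProduct.
Variables G H : pogroupType.

Definition lexcone (u : G \xlex H) : bool :=
  (0 < u.1) || (u.1 == 0) && (0 <= u.2).

Let lexcone0 : lexcone 0.
Proof. by rewrite /lexcone /= eqxx lexx orbT. Qed.

Let lexconeD u v : lexcone u -> lexcone v -> lexcone (u + v).
Proof.
case: u v => [x y] [z t]; rewrite /lexcone /=.
case/orP => [x0|/andP[/eqP-> y0]]; case/orP => [z0|/andP[/eqP-> t0]].
- by rewrite (lt_le_trans x0)// pog_lerDl ltW.
- by rewrite addr0 x0.
- by rewrite add0r z0.
- by rewrite addr0 eqxx pog_addr_ge0// orbT.
Qed.

Let lexcone_anti u : lexcone u -> lexcone (- u) -> u = 0.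
Proof.
case: u => [x y]; rewrite /lexcone /= oppr_eq0.
have N z : (0 : G) < z -> (0 < - z) = false.
  by move=> z0; rewrite le_gtF// -oppr0 pog_leN2 ltW.
case/orP => [x0|/andP[/eqP x0 y0]].
  by rewrite N //= (gt_eqF x0).
rewrite x0 oppr0 ltxx eqxx /= => Ny0; congr (_, _); apply/le_anti.
by rewrite y0 -[y]opprK -oppr0 pog_leN2 Ny0.
Qed.

HB.instance Definition _ :=
  Zmodule_hasPositiveCone.Build (G \xlex H) lexcone0 lexconeD lexcone_anti.

Lemma lexprod_leE (u v : G \xlex H) :
  (u <= v) = (u.1 < v.1) || (u.1 == v.1) && (u.2 <= v.2).
Proof.
rewrite -[LHS]/(lexcone (v - u)) /lexcone /= subr_eq0 !lt_def.
by rewrite !pog_subr_ge0 subr_eq0 [u.1 == _]eq_sym.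
Qed.

End LexProduct.

Section LexLattice.
Variables (G : togroupType) (H : lgroupType).
Implicit Types u v w : G \xlex H.

Definition lex_meet u v : G \xlex H :=
  if u.1 < v.1 then u else if v.1 < u.1 then v else (u.1, u.2 /|\ v.2).
Definition lex_join u v : G \xlex H :=
  if u.1 < v.1 then v else if v.1 < u.1 then u else (u.1, u.2 \|/ v.2).

Let tri (x y : G) : [\/ x < y, y < x | x = y].
Proof.
case: (eqVneq x y) => [->|xy]; first by constructor 3.
case/orP: (pog_le_total x y) => h; [constructor 1|constructor 2];
  by rewrite lt_neqAle h ?xy // eq_sym xy.
Qed.

Let le_lex_meet u v w : (w <= lex_meet u v) = (w <= u) && (w <= v).
Proof.
rewrite /lex_meet; case: (tri u.1 v.1) => uv.
- rewrite uv; case wu : (w <= u) => //=; apply/esym; move: wu.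
  rewrite !lexprod_leE => /orP[wu|/andP[/eqP-> _]]; last by rewrite uv.
  by rewrite (lt_trans wu uv).
- rewrite (lt_gtF uv) uv andbC; case wv : (w <= v) => //=; apply/esym; move: wv.
  rewrite !lexprod_leE => /orP[wv|/andP[/eqP-> _]]; last by rewrite uv.
  by rewrite (lt_trans wv uv).
- rewrite uv ltxx !lexprod_leE /= uv le_lmeet.
  by case: (w.1 < v.1) => //=; case: (w.1 == v.1).
Qed.

Let lex_join_le u v w : (lex_join u v <= w) = (u <= w) && (v <= w).
Proof.
rewrite /lex_join; case: (tri u.1 v.1) => uv.
- rewrite uv andbC; case vw : (v <= w) => //=; apply/esym; move: vw.
  rewrite !lexprod_leE => /orP[vw|/andP[/eqP<- _]]; last by rewrite uv.
  by rewrite (lt_trans uv vw).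
- rewrite (lt_gtF uv) uv; case uw : (u <= w) => //=; apply/esym; move: uw.
  rewrite !lexprod_leE => /orP[uw|/andP[/eqP<- _]]; last by rewrite uv.
  by rewrite (lt_trans uv uw).
- rewrite uv ltxx !lexprod_leE /= uv ljoin_le.
  by case: (v.1 < w.1) => //=; case: (v.1 == w.1).
Qed.

HB.instance Definition _ :=
  POGroup_isLGroup.Build (G \xlex H) le_lex_meet lex_join_le.

End LexLattice.

Definition Zchain d (L : orderType d) : Type := {freeg L / int}.

HB.instance Definition _ d (L : orderType d) := GRing.Zmodule.on (Zchain L).

Section Zchain.
Context d (L : orderType d).
Implicit Types x y : Zchain L.

Definition zcone x : bool :=
  (x == 0) || has (fun xi => (0 < coeff xi x) &&
                             all (fun eta => (eta <= xi)%O) (dom x)) (dom x).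

Lemma zconeP x : zcone x <-> x = 0 \/ exists xi : L, 0 < coeff xi x /\
  forall eta, coeff eta x != 0 -> (eta <= xi)%O.
Proof.
split.
  case/orP => [/eqP|/hasP[xi _ /andP[x0 /allP xm]]]; [by left|right].
  by exists xi; split=> // eta ex; apply: xm; rewrite mem_dom.
move=> [->|[xi [x0 xm]]]; rewrite /zcone ?eqxx//; apply/orP; right.
apply/hasP; exists xi; first by rewrite mem_dom gt_eqF.
by rewrite x0; apply/allP => eta; rewrite mem_dom; apply: xm.
Qed.

Let zcone0 : zcone 0. Proof. by rewrite /zcone eqxx. Qed.

Let zconeD x y : zcone x -> zcone y -> zcone (x + y).
Proof.
move=> /zconeP[->|[xi [x0 xm]]]; first by rewrite add0r.
move=> /zconeP[->|[eta [y0 ym]]].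
  by rewrite addr0; apply/zconeP; right; exists xi.
have out z (u : Zchain L) zeta :
    (forall eta, coeff eta u != 0 -> (eta <= zeta)%O) -> (zeta < z)%O ->
    coeff z u = 0.
  by move=> um zz; apply/eqP/negPn/negP => /um; rewrite leNgt zz.
apply/zconeP; right.
have sub zeta : coeff zeta (x + y) != 0 ->
    coeff zeta x != 0 \/ coeff zeta y != 0.
  rewrite coeffD; case: (eqVneq (coeff zeta x) 0) => [->|]; last by left.
  by rewrite add0r; right.
case: (ltgtP xi eta) => h.
- exists eta; split; first by rewrite coeffD (out _ _ _ xm h) add0r.
  by move=> z /sub[/xm zx|/ym//]; rewrite (le_trans zx) ?ltW.
- exists xi; split; first by rewrite coeffD (out _ _ _ ym h) addr0.
  by move=> z /sub[/xm//|/ym zy]; rewrite (le_trans zy) ?ltW.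
- subst eta; exists xi; split; first by rewrite coeffD addr_gt0.
  by move=> z /sub[/xm|/ym].
Qed.

Let zcone_anti x : zcone x -> zcone (- x) -> x = 0.
Proof.
move=> /zconeP[//|[xi [x0 xm]]] /zconeP[/eqP|[eta [y0 ym]]].
  by rewrite oppr_eq0 => /eqP.
move: y0; rewrite coeffN oppr_gt0 => y0.
have e1 : (eta <= xi)%O by apply: xm; rewrite lt_eqF.
have e2 : (xi <= eta)%O by apply: ym; rewrite coeffN oppr_eq0 gt_eqF.
have e : xi = eta by apply/le_anti; rewrite e1 e2.
by move: y0; rewrite -e => /(lt_trans x0); rewrite ltxx.
Qed.

HB.instance Definition _ :=
  Zmodule_hasPositiveCone.Build (Zchain L) zcone0 zconeD zcone_anti.

Let seq_max (s : seq L) : s != [::] ->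
  exists2 m, m \in s & forall z, z \in s -> (z <= m)%O.
Proof.
elim: s => // a [|b s] IH _.
  by exists a; rewrite ?mem_head// => z; rewrite inE => /eqP->.
have [//|m ms mm] := IH; case: (leP a m) => am.
  by exists m; rewrite 1?inE ?ms ?orbT// => z; rewrite inE => /orP[/eqP->|/mm].
exists a; rewrite ?mem_head// => z; rewrite inE => /orP[/eqP->//|/mm zm].
exact: le_trans zm (ltW am).
Qed.

Let zchain_total x y : (x <= y) || (y <= x).
Proof.
rewrite -[x <= y]/(zcone (y - x)) -[y <= x]/(zcone (x - y)) -[x - y]opprB.
set z := y - x; case: (eqVneq z 0) => [->|z0]; first by rewrite /zcone eqxx.
have [|m] := @seq_max (dom z); first by rewrite dom_eq0.
rewrite mem_dom => m0 mm.
have [mp|mn|me] := ltgtP (coeff m z) 0; last by rewrite me eqxx in m0.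
  apply/orP; right; apply/zconeP; right; exists m.
  rewrite coeffN oppr_gt0; split=> // eta; rewrite coeffN oppr_eq0 => ez.
  by apply: mm; rewrite mem_dom.
apply/orP; left; apply/zconeP; right; exists m; split=> // eta ez.
by apply: mm; rewrite mem_dom.
Qed.

HB.instance Definition _ := POGroup_isTotal.Build (Zchain L) zchain_total.

End Zchain.

Inductive lterm : Type :=
| Ta | Tb | T0
| Topp of lterm
| Tadd of lterm & lterm
| Tmeet of lterm & lterm
| Tjoin of lterm & lterm.

HB.instance Definition _ := gen_eqMixin lterm.
HB.instance Definition _ := gen_choiceMixin lterm.

(* The congruence on terms generated by an equational axiomatization of Abelian
   l-groups together with the relations a >= 0 and b >= 0. *)
Inductive lcong : lterm -> lterm -> Prop :=
| lcong_refl t : lcong t t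
| lcong_sym s t : lcong s t -> lcong t s
| lcong_trans s t u : lcong s t -> lcong t u -> lcong s u
| lcong_opp s s' : lcong s s' -> lcong (Topp s) (Topp s')
| lcong_add s s' t t' :
    lcong s s' -> lcong t t' -> lcong (Tadd s t) (Tadd s' t')
| lcong_meet s s' t t' :
    lcong s s' -> lcong t t' -> lcong (Tmeet s t) (Tmeet s' t')
| lcong_join s s' t t' :
    lcong s s' -> lcong t t' -> lcong (Tjoin s t) (Tjoin s' t')
| lcong_addA s t u : lcong (Tadd s (Tadd t u)) (Tadd (Tadd s t) u)
| lcong_addC s t : lcong (Tadd s t) (Tadd t s)
| lcong_add0 t : lcong (Tadd T0 t) t
| lcong_addN t : lcong (Tadd (Topp t) t) T0
| lcong_meetA s t u : lcong (Tmeet s (Tmeet t u)) (Tmeet (Tmeet s t) u)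
| lcong_meetC s t : lcong (Tmeet s t) (Tmeet t s)
| lcong_joinA s t u : lcong (Tjoin s (Tjoin t u)) (Tjoin (Tjoin s t) u)
| lcong_joinC s t : lcong (Tjoin s t) (Tjoin t s)
| lcong_meetK s t : lcong (Tmeet s (Tjoin s t)) s
| lcong_joinK s t : lcong (Tjoin s (Tmeet s t)) s
| lcong_meetD s t u :
    lcong (Tadd s (Tmeet t u)) (Tmeet (Tadd s t) (Tadd s u))
| lcong_a : lcong (Tmeet T0 Ta) T0
| lcong_b : lcong (Tmeet T0 Tb) T0.

Definition lcongb (s t : lterm) : bool := `[< lcong s t >].

Lemma lcongb_refl : reflexive lcongb.
Proof. by move=> t; apply/asboolP; constructor. Qed.
Lemma lcongb_sym : symmetric lcongb.
Proof. by move=> s t; apply/asboolP/asboolP; apply: lcong_sym. Qed.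
Lemma lcongb_trans : transitive lcongb.
Proof.
by move=> t s u /asboolP st /asboolP tu; apply/asboolP/(lcong_trans st tu).
Qed.

Canonical lcong_equiv := EquivRel lcongb lcongb_refl lcongb_sym lcongb_trans.
Canonical lcong_equiv_direct := defaultEncModRel lcongb.

Definition Fab : Type := {eq_quot lcongb}%qT.

HB.instance Definition _ := Choice.on Fab.
HB.instance Definition _ := Quotient.on Fab.

Section Fab.
Implicit Types x y z : Fab.
Local Notation cl t := (\pi_Fab%qT t).

Lemma Fab_eqP s t : cl s = cl t <-> lcong s t.
Proof. by split => [/eqmodP/asboolP|st]; last by apply/eqmodP/asboolP. Qed.

Let cl_repr x : cl (repr x) = x. Proof. exact: reprK. Qed.
Let repr_cl t : lcong (repr (cl t)) t. Proof. exact/Fab_eqP/reprK. Qed.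

Definition Fab_a : Fab := cl Ta.
Definition Fab_b : Fab := cl Tb.
Definition Fab_0 : Fab := cl T0.
Definition Fab_opp x : Fab := cl (Topp (repr x)).
Definition Fab_add x y : Fab := cl (Tadd (repr x) (repr y)).
Definition Fab_meet x y : Fab := cl (Tmeet (repr x) (repr y)).
Definition Fab_join x y : Fab := cl (Tjoin (repr x) (repr y)).

Lemma Fab_oppE t : Fab_opp (cl t) = cl (Topp t).
Proof. exact/Fab_eqP/lcong_opp. Qed.
Lemma Fab_addE s t : Fab_add (cl s) (cl t) = cl (Tadd s t).
Proof. exact/Fab_eqP/lcong_add. Qed.
Lemma Fab_meetE s t : Fab_meet (cl s) (cl t) = cl (Tmeet s t).
Proof. exact/Fab_eqP/lcong_meet. Qed.
Lemma Fab_joinE s t : Fab_join (cl s) (cl t) = cl (Tjoin s t).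
Proof. exact/Fab_eqP/lcong_join. Qed.

Let FabE := (Fab_oppE, Fab_addE, Fab_meetE, Fab_joinE).
Local Ltac fab :=
  let E := fresh "E" in hnf; repeat (elim/quotW => ?);
  have E := (Fab_oppE, Fab_addE, Fab_meetE, Fab_joinE); move: E;
  rewrite -/Fab_0; generalize Fab_opp Fab_add Fab_meet Fab_join;
  move=> ? ? ? ? E; rewrite /Fab_0 ?E; apply/Fab_eqP; constructor.

Let Fab_addA : associative Fab_add. Proof. by fab. Qed.
Let Fab_addC : commutative Fab_add. Proof. by fab. Qed.
Let Fab_add0 : left_id Fab_0 Fab_add. Proof. by fab. Qed.
Let Fab_addN : left_inverse Fab_0 Fab_opp Fab_add. Proof. by fab. Qed.
Let Fab_meetA : associative Fab_meet. Proof. by fab. Qed.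
Let Fab_meetC : commutative Fab_meet. Proof. by fab. Qed.
Let Fab_joinA : associative Fab_join. Proof. by fab. Qed.
Let Fab_joinC : commutative Fab_join. Proof. by fab. Qed.
Let Fab_meetK x y : Fab_meet x (Fab_join x y) = x.
Proof. by move: x y; fab. Qed.
Let Fab_joinK x y : Fab_join x (Fab_meet x y) = x.
Proof. by move: x y; fab. Qed.
Let Fab_meetD x y z :
  Fab_add x (Fab_meet y z) = Fab_meet (Fab_add x y) (Fab_add x z).
Proof. by move: x y z; fab. Qed.

HB.instance Definition _ :=
  GRing.isZmodule.Build Fab Fab_addA Fab_addC Fab_add0 Fab_addN.

Let Fab_le x y : bool := Fab_meet x y == x.

Let Fab_meetxx x : Fab_meet x x = x.
Proof. by rewrite -{2}(Fab_joinK x x) Fab_meetK. Qed.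
Let Fab_le_refl : reflexive Fab_le.
Proof. by move=> x; apply/eqP/Fab_meetxx. Qed.
Let Fab_le_anti : antisymmetric Fab_le.
Proof. by move=> x y /andP[/eqP xy /eqP yx]; rewrite -xy Fab_meetC. Qed.
Let Fab_le_trans : transitive Fab_le.
Proof.
by move=> y x z /eqP xy /eqP yz; apply/eqP; rewrite -{1}xy -Fab_meetA yz.
Qed.

HB.instance Definition _ := Order.Le_isPOrder.Build ring_display Fab
  Fab_le_refl Fab_le_anti Fab_le_trans.

Let leE x y : (x <= y) = (Fab_meet x y == x). Proof. by []. Qed.

Let Fab_le_add2l z x y : x <= y -> z + x <= z + y.
Proof.
rewrite !leE => /eqP xy; apply/eqP.
by rewrite -[z + x]/(Fab_add z x) -[z + y]/(Fab_add z y) -Fab_meetD xy.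
Qed.

HB.instance Definition _ := POrderedZmodule_isPOGroup.Build Fab Fab_le_add2l.

Let leEjoin x y : (x <= y) = (Fab_join y x == y).
Proof.
rewrite leE; apply/eqP/eqP => <-; first by rewrite Fab_meetC Fab_joinK.
by rewrite Fab_joinC Fab_meetK.
Qed.

Let Fab_le_lmeet x y z : (z <= Fab_meet x y) = (z <= x) && (z <= y).
Proof.
rewrite !leE; apply/eqP/andP => [<-|[/eqP zx /eqP zy]].
  split; apply/eqP; last by rewrite -!Fab_meetA Fab_meetxx.
  by rewrite (Fab_meetC x) -!Fab_meetA Fab_meetxx.
by rewrite Fab_meetA zx zy.
Qed.

Let Fab_ljoin_le x y z : (Fab_join x y <= z) = (x <= z) && (y <= z).
Proof.
have joinxx u : Fab_join u u = u by rewrite -{2}(Fab_meetK u u) Fab_joinK.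
rewrite !leEjoin; apply/eqP/andP => [<-|[/eqP zx /eqP zy]].
  split; apply/eqP; last by rewrite -!Fab_joinA joinxx.
  by rewrite (Fab_joinC x) -!Fab_joinA joinxx.
by rewrite Fab_joinA zx zy.
Qed.

HB.instance Definition _ :=
  POGroup_isLGroup.Build Fab Fab_le_lmeet Fab_ljoin_le.

Lemma Fab_a_ge0 : 0 <= Fab_a.
Proof. by apply/eqP; rewrite FabE; apply/Fab_eqP; constructor. Qed.
Lemma Fab_b_ge0 : 0 <= Fab_b.
Proof. by apply/eqP; rewrite FabE; apply/Fab_eqP; constructor. Qed.

Fixpoint lterm_eval (H : lgroupType) (x y : H) (t : lterm) : H :=
  match t with
  | Ta => x | Tb => y | T0 => 0
  | Topp t => - lterm_eval x y t
  | Tadd s t => lterm_eval x y s + lterm_eval x y t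
  | Tmeet s t => lterm_eval x y s /|\ lterm_eval x y t
  | Tjoin s t => lterm_eval x y s \|/ lterm_eval x y t
  end.

Lemma lterm_eval_cong (H : lgroupType) (x y : H) : 0 <= x -> 0 <= y ->
  forall s t, lcong s t -> lterm_eval x y s = lterm_eval x y t.
Proof.
move=> x0 y0 s t; elim=> //=.
- by move=> ? ? ? _ -> _ ->.
- by move=> ? ? _ ->.
- by move=> ? ? ? ? _ -> _ ->.
- by move=> ? ? ? ? _ -> _ ->.
- by move=> ? ? ? ? _ -> _ ->.
- by move=> ? ? ?; rewrite addrA.
- by move=> ? ?; rewrite addrC.
- by move=> ?; rewrite add0r.
- by move=> ?; rewrite addNr.
- by move=> ? ? ?; apply: lmeet_eq => u; rewrite !le_lmeet andbA.
- by move=> ? ?; rewrite lmeetC.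
- by move=> ? ? ?; apply: ljoin_eq => u; rewrite !ljoin_le andbA.
- by move=> ? ?; apply: ljoin_eq => u; rewrite ljoin_le andbC.
- by move=> ? ?; apply: lmeet_l; rewrite le_ljoinl.
- move=> u v; apply: ljoin_eq => w; apply/idP/andP => [uw|[]//].
  by split=> //; apply: le_trans uw; exact: lmeet_lel.
- by move=> ? ? ?; rewrite lmeetDl.
- exact: lmeet_l.
- exact: lmeet_l.
Qed.

Lemma Fab_universal (H : lgroupType) (x y : H) : 0 <= x -> 0 <= y ->
  exists! f : Fab -> H,
    [/\ {morph f : u v / u + v}, {morph f : u v / u /|\ v},
        {morph f : u v / u \|/ v}, f Fab_a = x & f Fab_b = y].
Proof.
move=> x0 y0; pose f (u : Fab) := lterm_eval x y (repr u).
have fE t : f (cl t) = lterm_eval x y t.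
  exact: (lterm_eval_cong x0 y0 (repr_cl t)).
exists f; split.
  by split; rewrite ?fE//; elim/quotW => s; elim/quotW => t;
    rewrite -?[cl s + cl t]/(Fab_add _ _) -?[cl s /|\ cl t]/(Fab_meet _ _)
      -?[cl s \|/ cl t]/(Fab_join _ _) FabE !fE.
move=> g [gD gI gU ga gb]; apply/funext => u.
have g0 : g 0 = 0 by apply: (addIr (g 0)); rewrite -gD !add0r.
rewrite -[u]cl_repr fE; elim: (repr u) => //=.
- move=> t IH; rewrite -Fab_oppE -[Fab_opp _]/(- cl t).
  by apply: (addIr (g (cl t))); rewrite -gD !addNr IH addNr g0.
- by move=> s -> t ->; rewrite -gD -[_ + _]/(Fab_add _ _) FabE.
- by move=> s -> t ->; rewrite -gI -[_ /|\ _]/(Fab_meet _ _) FabE.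
- by move=> s -> t ->; rewrite -gU -[_ \|/ _]/(Fab_join _ _) FabE.
Qed.

End Fab.

Definition wo_set : Type := set nat.

HB.instance Definition _ := Choice.on wo_set.

Definition wo_le : rel wo_set := sval (well_ordering_principle wo_set).

Lemma wo_leP : well_order wo_le.
Proof. exact: svalP (well_ordering_principle wo_set). Qed.

Fact wo_display : Order.disp_t. Proof. exact: Order.Disp tt tt. Qed.

Lemma wo_le_min (A : set wo_set) x : A x ->
  exists2 z, A z & forall y, A y -> wo_le z y.
Proof.
move=> Ax; pose B : {pred wo_set} := [pred y | `[< A y >]].
have [|z [[/asboolP Az zmin] _]] := wo_leP (A := B).
  by exists x; apply/asboolP.
by exists z => // y Ay; apply/zmin/asboolP.
Qed.

Section WellOrder.

Let wo_le_refl : reflexive wo_le.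
Proof. by move=> x; have [z -> zz] := @wo_le_min [set x] x erefl; apply: zz. Qed.

Let wo_le_total : total wo_le.
Proof.
move=> x y; have [|z [->|->] zm] := @wo_le_min [set x; y] x; first by left.
  by rewrite zm //; right.
by rewrite orbC zm //; left.
Qed.

Let wo_le_anti : antisymmetric wo_le.
Proof.
move=> x y /andP[xy yx].
pose B : {pred wo_set} := [pred z | (z == x) || (z == y)].
have [|z [_ zu]] := wo_leP (A := B); first by exists x; rewrite inE eqxx.
rewrite -(zu x) ?(zu y) //; split; rewrite ?inE ?eqxx ?orbT//;
  by move=> t; rewrite inE => /orP[]/eqP->; rewrite ?wo_le_refl ?xy ?yx.
Qed.

Let wo_le_trans : transitive wo_le.
Proof.
move=> y x z xy yz.
have [|m [[->|->]|->] mm] := @wo_le_min [set x; y; z] x; first by left; left.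
- by apply: mm; right.
- have -> // : x = y by apply: wo_le_anti; rewrite xy mm//; left; left.
- have <- // : y = z by apply: wo_le_anti; rewrite yz mm//; left; right.
Qed.

HB.instance Definition _ := Order.Le_isPOrder.Build wo_display wo_set
  wo_le_refl wo_le_anti wo_le_trans.
HB.instance Definition _ :=
  Order.POrder_isTotal.Build wo_display wo_set wo_le_total.

End WellOrder.

(* The points of [wo_set] with countably many predecessors form its initial
   segment of order type omega_1. *)
Record omega1 := Omega1 {
  omega1_val :> wo_set;
  _ : `[< countable [set y : wo_set | (y < omega1_val)%O] >] }.

HB.instance Definition _ := [isSub for omega1_val].
HB.instance Definition _ := [Choice of omega1 by <:].
HB.instance Definition _ :=
  [SubChoice_isSubOrder of omega1 by <: with wo_display].

(* The three facts below say that [omega1] is a well-ordered uncountable set all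
   of whose proper initial segments are countable, i.e. has order type omega_1. *)
Lemma omega1_wf (A : set omega1) x : A x ->
  exists2 z, A z & forall y, A y -> (z <= y)%O.
Proof.
move=> Ax; have [|_ [z Az <-] zm] := @wo_le_min (omega1_val @` A) (omega1_val x).
  by exists x.
by exists z => // y Ay; apply: zm; exists y.
Qed.

Lemma omega1_countable_below (x : omega1) :
  countable [set y : omega1 | (y < x)%O].
Proof.
case: x => x /= cx; have /asboolP/countable_injP[f fI] := cx.
apply/countable_injP; exists (f \o omega1_val) => y z.
rewrite !inE /= => yx zx /fI yz; apply/val_inj/yz; rewrite inE; [exact: yx|exact: zx].
Qed.

Lemma omega1_uncountable : ~ countable [set: omega1].
Proof.
move=> om; pose S : set wo_set := range omega1_val.
have cS : countable S by apply: sub_countable om; apply: card_image_le.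
have [ST|] := pselect (forall x, S x).
  have /countable_injP[f fI] := cS.
  pose D : wo_set := [set n | exists2 X : wo_set, f X = n & ~ X n].
  have nD : ~ D (f D).
    move=> DD; have [X fX nX] := DD; apply: nX; suff -> : X = D by exact: DD.
    by apply: fI; rewrite ?inE.
  by apply: (nD); exists D.
move=> /existsNP[x nSx].
have [z nSz zm] := @wo_le_min (~` S) x nSx.
apply: nSz; suff cz : `[< countable [set y | (y < z)%O] >] by exists (Omega1 cz).
apply/asboolP/(sub_countable _ cS)/subset_card_le => y /= yz.
by apply/notP => /zm zy; move: yz; rewrite ltNge => /negP; apply; exact: zy.
Qed.

Definition Gchain d (L : orderType d) : lgroupType := Zchain L \xlex Fab.

(* Main.v *)
Require Import Defs.
From HB Require Import structures.
From mathcomp Require Import all_boot all_order all_algebra.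
From mathcomp Require Import boolp classical_sets cardinality.
From mathcomp Require Import zify.
From mathcomp.multinomials Require Import freeg.

Set Implicit Arguments.
Unset Strict Implicit.
Unset Printing Implicit Defensive.

Import Order.TTheory GRing.Theory Num.Theory.

Local Open Scope classical_set_scope.
Local Open Scope ring_scope.

(* Write m x for the image under mu of the radical l-ideal generated by x, and
   choose x, y, e_xi >= 0 in A with m x = <a>, m y = <b> and m e_xi = <c_xi>.
   The positive and negative parts of x - y e_xi have images U_xi, V_xi below
   <a> and <b>, hence principal ideals of the countable l-group F.  If the chain
   is uncountable, then (U_xi, V_xi) = (U_eta, V_eta) = (U, V) for some
   xi < eta.  The join of U and V then contains the image of
   (x - y e_xi) - (x - y e_eta) = y (e_eta - e_xi), which is <b> because
   e_eta - e_xi has an image above F; as x <= (x - y e_xi)^+ + y e_xi, it also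
   contains <a>.  So U and V would be disjoint, with join <a> \/ <b>, U below <a>
   and V below <b>: they would disconnect the segment of slopes [0, oo] that
   represents F. *)

(** * Principal members among the finitely generated closed sets *)

Section Principal.
Variables (T : choiceType) (C : set T -> Prop).

Lemma principal_subproof (x : T) :
  `[< finitely_generated C (smallest C [set` [:: x]]) >].
Proof. by apply/asboolP; exists [:: x]. Qed.

Definition principal (x : T) : fgclosed C := FGClosed (principal_subproof x).

Hypothesis C_bigcap : forall F : set (set T),
  (forall I, F I -> C I) -> C (\bigcap_(I in F) I).

Lemma principal_le (I : fgclosed C) x : (principal x <= I)%O <-> (I : set T) x.
Proof.
split => [/fgclosed_le|Ix].
  by apply; apply: sub_gen_smallest; rewrite /= inE.
apply/fgclosed_le; apply: smallest_sub; first exact: fgclosed_C.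
by move=> y /=; rewrite inE => /eqP ->.
Qed.

Lemma mem_principal x : (principal x : set T) x.
Proof. exact/principal_le. Qed.

End Principal.

Lemma is_lideal_sum_labs (G : lgroupType) (I : set G) (s : seq G) :
  is_lideal I -> I (\sum_(y <- s) labs y) <-> (forall y, y \in s -> I y).
Proof.
move=> II; elim: s => [|x s [IH1 IH2]].
  by rewrite big_nil; split=> // _; case: II => -[].
rewrite big_cons; have s0 : 0 <= \sum_(y <- s) labs y.
  elim: s {IH1 IH2} => [|y s IH]; first by rewrite big_nil.
  by rewrite big_cons pog_addr_ge0 ?labs_ge0.
split=> [Ixs|Is].
  move=> y; rewrite inE => /orP[/eqP->|ys].
    apply: (is_lideal_of_abs II); apply: (is_lideal_ge0 II Ixs).
      exact: labs_ge0.
    by rewrite pog_lerDl.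
  by apply: IH1 ys; apply: (is_lideal_ge0 II Ixs); rewrite // pog_lerDr labs_ge0.
apply: (is_lidealD II); first by apply/(is_lideal_abs II)/Is; rewrite mem_head.
by apply: IH2 => y ys; apply: Is; rewrite inE ys orbT.
Qed.

(** An l-ideal contains finitely many elements iff it contains the sum of their absolute values, so
    this sum replaces the generators. With [C] left general, the argument covers both l-ideals and
    radical l-ideals. *)
Lemma fgclosed_principal (G : lgroupType) (C : set G -> Prop) :
  (forall F : set (set G), (forall I, F I -> C I) -> C (\bigcap_(I in F) I)) ->
  (forall I, C I -> is_lideal I) ->
  forall I : fgclosed C, exists2 x, 0 <= x & I = principal C x.
Proof.
move=> C_bigcap C_lideal I; have CI := fgclosed_C C_bigcap I.
case: I CI => J fgJ /= CJ; have /asboolP[s Js] := fgJ.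
exists (\sum_(y <- s) labs y).
  elim: (s) => [|y r IH]; first by rewrite big_nil.
  by rewrite big_cons pog_addr_ge0 ?labs_ge0.
apply/le_anti/andP; split; last first.
  apply/principal_le => //=; apply: (is_lideal_sum_labs s (C_lideal _ CJ)).2.
  by move=> y ys; rewrite Js; apply: sub_gen_smallest.
apply/fgclosed_le; rewrite /= Js; apply: smallest_sub.
  exact: (fgclosed_C C_bigcap (principal C _)).
apply: (is_lideal_sum_labs s _).1; last exact: mem_principal.
exact/C_lideal/(fgclosed_C C_bigcap (principal C _)).
Qed.

(** * Principal radical l-ideals of a commutative f-ring *)

Section PrincipalRadical.
Variable A : comFringType.
Implicit Types x y z : A.

Definition rp x : Idrc A := principal (@is_radical_lideal A) x.

Lemma rp_le (I : Idrc A) x : (rp x <= I)%O <-> (I : set A) x.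
Proof. by apply: principal_le; exact: is_radical_lideal_bigcap. Qed.

Lemma Idrc_radical (I : Idrc A) : is_radical_lideal (I : set _).
Proof. by apply: fgclosed_C; exact: is_radical_lideal_bigcap. Qed.

Lemma mem_rp x : (rp x : set _) x.
Proof. exact/rp_le. Qed.

Lemma rp_leU x y z : labs z <= labs x + labs y -> (rp z <= rp x `|` rp y)%O.
Proof.
move=> zxy; apply/rp_le; have [[II _] _] := Idrc_radical (rp x `|` rp y)%O.
apply: (is_lideal_of_abs II); apply: (is_lideal_ge0 II _ (labs_ge0 z) zxy).
by apply: (is_lidealD II); apply: (is_lideal_abs II); apply/rp_le;
  rewrite ?leUl ?leUr.
Qed.

Lemma rp_mul_le x y : (rp (x *# y) <= rp x)%O.
Proof.
apply/rp_le; have [[_ IM] _] := Idrc_radical (rp x).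
by have [_] := IM y x (@mem_rp x).
Qed.

(** Two passages through polars, first in [y] and then in [x], show that the square of [labs z] lies
    in [rp (x *# y)]; radicality removes the square. *)
Lemma rp_leM x y : (rp x `&` rp y <= rp (x *# y))%O.
Proof.
apply/fgclosed_le => z [zx zy].
have RK := Idrc_radical (rp (x *# y)); have [[II _] IR] := RK.
set K : set A := (rp (x *# y) : set _).
have xK : (rp x : set _) `<=` lmul_polar K [set y].
  apply: smallest_sub; first exact: is_radical_lideal_polar.
  move=> t /=; rewrite inE => /eqP-> _ ->; rewrite -labsM.
  by apply: (is_lideal_abs II); apply: mem_rp.
have yK : (rp y : set _) `<=` lmul_polar K (rp x : set _).
  apply: smallest_sub; first exact: is_radical_lideal_polar.
  by move=> t /=; rewrite inE => /eqP-> s sx; rewrite lmulC; apply: xK.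
by apply: (is_lideal_of_abs II); apply: (IR _ 2) => //; exact: yK.
Qed.

Lemma rp0_le (I : Idrc A) : (rp 0 <= I)%O.
Proof. by apply/rp_le; have [[[[]]]] := Idrc_radical I. Qed.

Lemma Idrc_rp (I : Idrc A) : exists2 x, 0 <= x & I = rp x.
Proof.
apply: fgclosed_principal; first exact: is_radical_lideal_bigcap.
by move=> J [[]].
Qed.

End PrincipalRadical.

(** * Principal l-ideals of an Abelian l-group *)

Section PrincipalGroup.
Variable G : lgroupType.
Implicit Types x y z : G.

Definition lp x : Idlc G := principal (@is_lideal G) x.

Lemma lp_le (I : Idlc G) x : (lp x <= I)%O <-> (I : set G) x.
Proof. by apply: principal_le; exact: is_lideal_bigcap. Qed.

Lemma Idlc_lideal (I : Idlc G) : is_lideal (I : set _).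
Proof. by apply: fgclosed_C; exact: is_lideal_bigcap. Qed.

Lemma Idlc_lp (I : Idlc G) : exists2 x, 0 <= x & I = lp x.
Proof. by apply: fgclosed_principal => //; exact: is_lideal_bigcap. Qed.

Lemma lp_mono x y : 0 <= x -> x <= y -> (lp x <= lp y)%O.
Proof.
move=> x0 xy; apply/lp_le/(is_lideal_ge0 (Idlc_lideal _) _ x0 xy).
exact/lp_le.
Qed.

Lemma pog_mulrn_ge0 x n : 0 <= x -> 0 <= x *+ n.
Proof. by move=> x0; elim: n => // n IH; rewrite mulrS pog_addr_ge0. Qed.

(** The elements dominated in absolute value by a multiple of [x] form an l-ideal containing [x]. *)
Lemma lp_bounded x y : 0 <= x -> (lp x : set _) y ->
  exists n, labs y <= x *+ n.
Proof.
move=> x0; suff : (lp x : set _) `<=` [set y | exists n, labs y <= x *+ n].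
  exact.
apply: smallest_sub => [|z /=]; last first.
  by rewrite inE => /eqP->; exists 1%N; rewrite labs_id.
apply: is_lideal_labs => [|s t z [m sm] [n tn] zst].
  by exists 0%N; rewrite labs_id.
by exists (m + n)%N; rewrite mulrnDr (le_trans zst) ?pog_leD.
Qed.

Lemma lpU_le x y : 0 <= x -> 0 <= y -> (lp x `|` lp y <= lp (x + y))%O.
Proof.
by move=> x0 y0; rewrite leUx !lp_mono ?pog_lerDl ?pog_lerDr.
Qed.

Lemma lpI_eq0 x y : 0 <= x -> 0 <= y -> (lp x `&` lp y <= lp 0)%O ->
  x /|\ y = 0.
Proof.
move=> x0 y0 xy; have xy0 := lmeet_ge0 x0 y0.
have [||n] := @lp_bounded 0 (x /|\ y); first by [].
  apply/lp_le; apply: le_trans xy; rewrite lexI.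
  by rewrite !lp_mono ?lmeet_lel ?lmeet_ler.
by rewrite mul0rn labs_id// => h; apply/le_anti; rewrite h xy0.
Qed.

End PrincipalGroup.

(** * The l-ideals of the lexicographical product of a chain group with F *)

Section Gchain.
Context d (L : orderType d).
Local Notation G := (Gchain L).

Definition Gchain_gen (xi : L) : G := (<< xi >> : Zchain L, 0).
Definition Gchain_in (u : Fab) : G := (0, u).

Lemma Gchain_in_le u v : (Gchain_in u <= Gchain_in v) = (u <= v).
Proof. by rewrite lexprod_leE /= ltxx eqxx. Qed.

Lemma Gchain_in_ge0 u : (0 <= Gchain_in u) = (0 <= u).
Proof. exact: Gchain_in_le 0 u. Qed.

Lemma Gchain_inD u v : Gchain_in (u + v) = Gchain_in u + Gchain_in v.
Proof. by rewrite -[RHS]/(0 + 0, _) addr0. Qed.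

Lemma Gchain_inMn u n : Gchain_in u *+ n = Gchain_in (u *+ n).
Proof. by elim: n => // n IH; rewrite !mulrS IH Gchain_inD. Qed.

Lemma lt_Gchain_in (x : G) u : 0 < x.1 -> Gchain_in u <= x.
Proof. by move=> x0; rewrite lexprod_leE /= x0. Qed.

Lemma Gchain_fst_gt0 (h : G) : 0 <= h -> h.1 != 0 -> 0 < h.1.
Proof. by rewrite lexprod_leE /= [0 == _]eq_sym => /orP[//|/andP[->]]. Qed.

Lemma Gchain_genMn (xi : L) n : (Gchain_gen xi *+ n).1 = << xi >> *+ n.
Proof. by elim: n => // n IH; rewrite !mulrS -IH. Qed.

Lemma freeg1_gt0 (xi : L) : (0 : Zchain L) < << xi >>.
Proof.
rewrite lt_neqAle; apply/andP; split.
  apply/eqP => /(congr1 (coeff xi)).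
  by rewrite coeff0 coeffU eqxx mulr1 => /esym/eqP; rewrite oner_eq0.
rewrite -[_ <= _]/(zcone _) subr0; apply/zconeP; right; exists xi.
rewrite coeffU eqxx mulr1; split=> // eta.
by rewrite coeffU mul1r; have [->|] := eqVneq xi eta.
Qed.

Lemma Gchain_gen_ge0 (xi : L) : 0 <= Gchain_gen xi.
Proof. exact/lt_Gchain_in/freeg1_gt0. Qed.

(** In [<< xi >> *+ n - << eta >>] the leading coefficient is the one at [eta], namely -1, so no
    multiple of the smaller generator dominates the larger one. *)
Lemma Gchain_gen_nmem (xi eta : L) : (xi < eta)%O ->
  ~ (lp (Gchain_gen eta) <= lp (Gchain_gen xi))%O.
Proof.
move=> xe /lp_le /(lp_bounded (Gchain_gen_ge0 xi))[n].
rewrite labs_id ?Gchain_gen_ge0// => le_n.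
have : (<< eta >> : Zchain L) <= << xi >> *+ n.
  rewrite -Gchain_genMn; move: le_n; rewrite lexprod_leE.
  by case/orP => [/ltW|/andP[/eqP/= -> _]].
have cE zeta : coeff zeta (<< xi >> *+ n - << eta >> : Zchain L) =
    (xi == zeta)%:R *+ n - (eta == zeta)%:R :> int.
  by rewrite coeffB coeffMn !coeffU !mul1r.
rewrite -[_ <= _]/(zcone _) => /zconeP[/(congr1 (coeff eta))|[zeta []]].
  by rewrite cE coeff0 (lt_eqF xe) eqxx mul0rn sub0r.
rewrite cE; case: (eqVneq xi zeta) => [<- _|xz].
  move=> /(_ eta); rewrite cE (lt_eqF xe) eqxx mul0rn sub0r oppr_eq0 oner_eq0.
  by move=> /(_ isT); rewrite leNgt xe.
by rewrite mul0rn sub0r oppr_gt0 ltNge ler0n.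
Qed.

(** Either [J] has an element with nonzero first coordinate, whose absolute value then exceeds all
    of F, or [J] lies inside F, hence below the generator at [xi]. The latter would put the
    generator at [eta] in the l-ideal of the one at [xi]. *)
Lemma Gchain_gap (J : Idlc G) (xi eta : L) (u : Fab) : (xi < eta)%O -> 0 <= u ->
  (lp (Gchain_gen eta) <= J `|` lp (Gchain_gen xi))%O ->
  (lp (Gchain_in u) <= J)%O.
Proof.
move=> xe u0 Jxe; have IJ := Idlc_lideal J.
have [[h Jh h0]|noh] := pselect (exists2 h : G, (J : set G) h & h.1 != 0).
  apply/lp_le/(is_lideal_ge0 IJ (is_lideal_abs IJ Jh)).
    by rewrite Gchain_in_ge0.
  apply: lt_Gchain_in; apply: Gchain_fst_gt0; first exact: labs_ge0.
  (* Both [h] and [- h] lie below [labs h], so if the latter has first coordinate 0, then so has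
     [h]. *)
  apply: contra_neq h0 => a0.
  have := labs_ge0 h; have := le_labs h; have := leN_labs h.
  rewrite !lexprod_leE a0 /= ltxx eqxx /=.
  move=> h1 h2 _; apply/le_anti/andP; split.
    by case/orP: h2 => [/ltW|/andP[/eqP->]].
  rewrite -pog_leN2 oppr0.
  by case/orP: h1 => [/ltW|/andP[/eqP->]].
have JL : (J <= lp (Gchain_gen xi))%O.
  apply/fgclosed_le => h Jh; have IL := Idlc_lideal (lp (Gchain_gen xi)).
  apply: (is_lideal_of_abs IL).
  have Lxi := (lp_le _ _).1 (lexx (lp (Gchain_gen xi))).
  apply: (is_lideal_ge0 IL Lxi (labs_ge0 h)).
  have : (labs h).1 = 0.
    apply/eqP/negPn/negP => h0; apply: noh; exists (labs h) => //.
    exact: is_lideal_abs.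
  case: (labs h) => /= _ v ->; apply: lt_Gchain_in; exact: freeg1_gt0.
case: (Gchain_gen_nmem xe); apply: (le_trans Jxe).
by rewrite leUx JL lexx.
Qed.

(** A positive generator of [J] is bounded by a multiple of an element of F, which forces its first
    coordinate to be 0. *)
Lemma Idlc_Gchain_in (J : Idlc G) (u : Fab) :
  (J <= lp (Gchain_in u))%O -> 0 <= u ->
  exists2 v, 0 <= v & J = lp (Gchain_in v).
Proof.
have [[x v] x0 ->] := Idlc_lp J => /lp_le /[swap] u0.
have u0' : 0 <= Gchain_in u by rewrite Gchain_in_ge0.
move=> /(lp_bounded u0')[n]; rewrite labs_id// Gchain_inMn => xn.
have xE : x = 0.
  move: x0 xn; rewrite !lexprod_leE /= => x0 xn; apply/le_anti/andP; split.
    by case/orP: xn => [/ltW|/andP[/eqP->]].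
  by case/orP: x0 => [/ltW|/andP[/eqP<-]].
subst x; exists v => //.
by rewrite -(Gchain_in_ge0 v); exact: x0.
Qed.

Lemma Gchain_in_bounded (u v : Fab) : 0 <= u -> 0 <= v ->
  (lp (Gchain_in u) <= lp (Gchain_in v))%O -> exists n, u <= v *+ n.
Proof.
move=> u0 v0 /lp_le; have ge0 w : 0 <= w -> 0 <= Gchain_in w.
  by rewrite Gchain_in_ge0.
move=> /(lp_bounded (ge0 _ v0))[n].
by rewrite labs_id ?ge0// Gchain_inMn Gchain_in_le; exists n.
Qed.

End Gchain.

(** * Evaluation of F at integer points, and connectedness *)

Section IntLGroup.

Let int_le_add2l (z x y : int) : x <= y -> z + x <= z + y.
Proof. by rewrite lerD2l. Qed.
HB.instance Definition _ := POrderedZmodule_isPOGroup.Build int int_le_add2l.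

Let int_le_lmeet (x y z : int) : (z <= Num.min x y) = (z <= x) && (z <= y).
Proof. exact: le_min. Qed.
Let int_ljoin_le (x y z : int) : (Num.max x y <= z) = (x <= z) && (y <= z).
Proof. exact: ge_max. Qed.
HB.instance Definition _ :=
  POGroup_isLGroup.Build int int_le_lmeet int_ljoin_le.

End IntLGroup.

Lemma int_lmeetE (x y : int) : x /|\ y = Num.min x y. Proof. by []. Qed.
Lemma int_ljoinE (x y : int) : x \|/ y = Num.max x y. Proof. by []. Qed.

(** The step taken keeps [p + q] fixed. Bounds for two subterms add up, for minima and maxima as
    well as for sums. *)
Lemma lterm_eval_lipschitz (t : lterm) : exists l : int, forall p q : int,
  `|lterm_eval (p + 1) (q - 1) t - lterm_eval p q t| <= l.
Proof.
elim: t => [||||s [k IHs] t [l IHt]|s [k IHs] t [l IHt]|s [k IHs] t [l IHt]] /=.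
- by exists 1 => p q; lia.
- by exists 1 => p q; lia.
- by exists 0 => p q; lia.
- by move=> t [l IH]; exists l => p q; have := IH p q; lia.
- by exists (k + l) => p q; have := IHs p q; have := IHt p q; lia.
- exists (k + l) => p q; have := IHs p q; have := IHt p q.
  by rewrite !int_lmeetE; lia.
- exists (k + l) => p q; have := IHs p q; have := IHt p q.
  by rewrite !int_ljoinE; lia.
Qed.

Section FabEval.
Variables p q : int.
Hypotheses (p0 : 0 <= p) (q0 : 0 <= q).

(** For nonnegative [p] and [q], this is the l-homomorphism from F to the integers that sends the
    generators to [p] and [q]. *)
Definition Fab_eval (u : Fab) : int := lterm_eval p q (repr u).

Lemma Fab_evalE t : Fab_eval (\pi_Fab%qT t) = lterm_eval p q t.
Proof. by apply: lterm_eval_cong => //; apply/Fab_eqP/reprK. Qed.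

Lemma Fab_evalD u v : Fab_eval (u + v) = Fab_eval u + Fab_eval v.
Proof. exact: Fab_evalE. Qed.

Lemma Fab_evalI u v : Fab_eval (u /|\ v) = Num.min (Fab_eval u) (Fab_eval v).
Proof. exact: Fab_evalE. Qed.

Lemma Fab_eval0 : Fab_eval 0 = 0. Proof. exact: Fab_evalE. Qed.

Lemma Fab_evalMn u n : Fab_eval (u *+ n) = Fab_eval u * n%:Z.
Proof.
elim: n => [|n IH]; first by rewrite mulr0 Fab_eval0.
by rewrite mulrS Fab_evalD IH; lia.
Qed.

Lemma Fab_eval_le u v : u <= v -> Fab_eval u <= Fab_eval v.
Proof. by move=> /lmeet_l uv; rewrite -uv Fab_evalI; lia. Qed.

End FabEval.

(* A discrete connectedness argument: along the integer points of the segment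
   from (0, N) to (N, 0), the values of [u] and [v] change by bounded steps,
   exactly one of them is nonzero, and it is of size at least N / n. *)
Lemma Fab_connected (u v : Fab) k l n : 0 <= u -> 0 <= v -> u /|\ v = 0 ->
  u <= Fab_a *+ k -> v <= Fab_b *+ l -> Fab_a + Fab_b <= (u + v) *+ n -> False.
Proof.
move=> u0 v0 uv ua vb abn.
have [m um] : exists m : int, forall p q : int,
    `|Fab_eval (p + 1) (q - 1) u - Fab_eval p q u| <= m.
  exact: lterm_eval_lipschitz.
(* With [N] larger than [n] times the step bound, a value of [u] reached in one step from 0 is too
   small to satisfy the lower bound [N / n] that holds where [v] vanishes. *)
pose N := (n * `|m| + 1)%N.
have H i : (i <= N)%N -> let p := i%:Z in let q := N%:Z - i%:Z in
  [/\ [/\ 0 <= Fab_eval p q u, 0 <= Fab_eval p q v &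
      Num.min (Fab_eval p q u) (Fab_eval p q v) = 0],
    Fab_eval p q u <= p * k%:Z, Fab_eval p q v <= q * l%:Z &
    N%:Z <= (Fab_eval p q u + Fab_eval p q v) * n%:Z].
  move=> iN p q; have p0 : 0 <= p by [].
  have q0 : 0 <= q by rewrite /q; lia.
  have le := Fab_eval_le p0 q0; split; first split.
  - by have := le _ _ u0; rewrite Fab_eval0.
  - by have := le _ _ v0; rewrite Fab_eval0.
  - by rewrite -Fab_evalI// uv Fab_eval0.
  - by have := le _ _ ua; rewrite Fab_evalMn// Fab_evalE.
  - by have := le _ _ vb; rewrite Fab_evalMn// Fab_evalE.
  - have := le _ _ abn; rewrite Fab_evalMn// !Fab_evalD// !Fab_evalE//=.
    by rewrite /p /q; lia.
have u_eq0 i : (i <= N)%N -> Fab_eval i%:Z (N%:Z - i%:Z) u = 0.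
  elim: i => [|i IH] iN; first by have [[]] := H 0%N iN; lia.
  have := um i%:Z (N%:Z - i%:Z); rewrite (IH (ltnW iN)).
  have -> : i%:Z + 1 = i.+1%:Z by lia.
  have -> : N%:Z - i%:Z - 1 = N%:Z - i.+1%:Z by lia.
  have [[hu hv huv] _ _ hN] := H i.+1 iN.
  move: hu hv huv hN; set U := Fab_eval _ _ u; set V := Fab_eval _ _ v.
  move=> hu hv huv hN Um; have [//|Upos] : U = 0 \/ 0 < U by lia.
  have V0 : V = 0 by lia.
  by move: hN; rewrite V0 addr0 /N; nia.
(* At the endpoint [(N, 0)] the bound by the second generator makes [v] vanish too, so [u + v] is 0
   there, against the lower bound. *)
have [[_ hv _] _ hb hN] := H N (leqnn N).
move: hN hb hv; rewrite (u_eq0 N (leqnn N)) subrr mul0r.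
set V := Fab_eval _ _ v => hN hb hv; have V0 : V = 0 by lia.
by move: hN; rewrite V0 addr0 mul0r /N; lia.
Qed.

(** * Countability of F *)

Fixpoint lterm_code (t : lterm) : GenTree.tree nat :=
  match t with
  | Ta => GenTree.Node 0 [::] | Tb => GenTree.Node 1 [::]
  | T0 => GenTree.Node 2 [::]
  | Topp t => GenTree.Node 3 [:: lterm_code t]
  | Tadd s t => GenTree.Node 4 [:: lterm_code s; lterm_code t]
  | Tmeet s t => GenTree.Node 5 [:: lterm_code s; lterm_code t]
  | Tjoin s t => GenTree.Node 6 [:: lterm_code s; lterm_code t]
  end.

Lemma lterm_code_inj : injective lterm_code.
Proof.
elim=> [|||s IHs|s IHs t IHt|s IHs t IHt|s IHs t IHt] [|||s'|s' t'|s' t'|s' t'] //=.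
- by move=> [/IHs->].
- by move=> [/IHs-> /IHt->].
- by move=> [/IHs-> /IHt->].
- by move=> [/IHs-> /IHt->].
Qed.

Definition Fab_code (u : Fab) : nat := pickle (lterm_code (repr u)).

Lemma Fab_code_inj : injective Fab_code.
Proof.
move=> u v /(pcan_inj pickleK)/lterm_code_inj uv.
by rewrite -[u]reprK -[v]reprK uv.
Qed.

(** * A surjection onto the l-ideals forces the chain to be countable *)

Section Surjection.
Context d (L : orderType d) (A : comFringType).
Local Notation D := (Idlc (Gchain L)).
Variable mu : {lmorphism Idrc A -> D}.
Hypothesis mu_surj : forall J : D, exists I, mu I = J.

Let m x := mu (rp x).

Let m_surj J : exists x, 0 <= x /\ m x = J.
Proof. by have [I <-] := mu_surj J; have [x x0 ->] := Idrc_rp I; exists x. Qed.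

Let m_leU x y z : labs z <= labs x + labs y -> (m z <= m x `|` m y)%O.
Proof. by move=> /rp_leU zxy; rewrite -omorphU; apply: omorph_le. Qed.

Let m_le x y : labs x <= labs y -> (m x <= m y)%O.
Proof.
move=> xy; rewrite -[leRHS]joinxx; apply: m_leU.
by rewrite (le_trans xy)// pog_lerDl labs_ge0.
Qed.

Let m_mul_le x y : (m (x *# y) <= m x)%O.
Proof. by apply: omorph_le; exact: rp_mul_le. Qed.

Let m_leM x y : (m x `&` m y <= m (x *# y))%O.
Proof. by rewrite -omorphI; apply: omorph_le; exact: rp_leM. Qed.

(** By surjectivity, [mu] sends the least element to the least element. *)
Let m0_le J : (m 0 <= J)%O.
Proof. by have [I <-] := mu_surj J; apply: omorph_le; exact: rp0_le. Qed.

Lemma countable_of_surjection : countable [set: L].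
Proof.
have [x [x0 mx]] := m_surj (lp (Gchain_in L Fab_a)).
have [y [y0 my]] := m_surj (lp (Gchain_in L Fab_b)).
have /choice[e e_spec] xi := m_surj (lp (Gchain_gen xi)).
pose w xi := y *# e xi.
(* These are the positive and negative parts of [x - w xi], with difference [x - w xi] and meet
   0. *)
pose p xi := x - x /|\ w xi; pose q xi := w xi - x /|\ w xi.
have w0 xi : 0 <= w xi by apply: lmul_ge0 => //; case: (e_spec xi).
have p0 xi : 0 <= p xi by rewrite pog_subr_ge0 lmeet_lel.
have q0 xi : 0 <= q xi by rewrite pog_subr_ge0 lmeet_ler.
have pq0 xi : p xi /|\ q xi = 0 by rewrite -lmeetDr subrr.
have xw0 xi : 0 <= x /|\ w xi by rewrite lmeet_ge0.
have px xi : (m (p xi) <= m x)%O.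
  by apply: m_le; rewrite !labs_id// -pog_subr_ge0 /p opprB addrC subrK.
have qy xi : (m (q xi) <= m y)%O.
  apply: le_trans (m_mul_le y (e xi)); apply: m_le; rewrite -/(w xi).
  by rewrite !labs_id// -pog_subr_ge0 /q opprB addrC subrK.
(* The generator at [xi] lies above F, so [m (e xi)] contains [m y], and the product of [y] and
   [e xi] has the meet of their images as a lower bound. *)
have mw xi : m (w xi) = m y.
  apply/le_anti; rewrite m_mul_le /= (le_trans _ (m_leM _ _))// lexI lexx /=.
  rewrite my (e_spec xi).2; apply: lp_mono.
    by rewrite Gchain_in_ge0 Fab_b_ge0.
  exact/lt_Gchain_in/freeg1_gt0.
have /choice[f fP] xi : exists uv : Fab * Fab, [/\ 0 <= uv.1, 0 <= uv.2,
    m (p xi) = lp (Gchain_in L uv.1) & m (q xi) = lp (Gchain_in L uv.2)].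
  have [|u u0 pu] := @Idlc_Gchain_in _ L (m (p xi)) _ _ Fab_a_ge0.
    by rewrite -mx.
  have [|v v0 qv] := @Idlc_Gchain_in _ L (m (q xi)) _ _ Fab_b_ge0.
    by rewrite -my.
  by exists (u, v).
have f_neq xi eta : (xi < eta)%O -> f xi = f eta -> False.
  move=> xe fE; have [u0 v0 pu qv] := fP xi; have := fP eta.
  rewrite -fE => -[_ _ pu' qv']; move: u0 v0 pu qv pu' qv'.
  case: (f xi) => u v /= u0 v0 pu qv pu' qv'.
  set U := lp (Gchain_in L u) in pu pu'; set V := lp (Gchain_in L v) in qv qv'.
  pose g := e eta - e xi.
  have xwE zeta : labs (x - w zeta) <= labs (p zeta) + labs (q zeta).
    rewrite -(labsN (q zeta)); apply: le_trans (labsD _ _).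
    by rewrite opprB addrA subrK.
  have xw zeta : m (p zeta) = U -> m (q zeta) = V -> (m (x - w zeta) <= U `|` V)%O.
    by move=> <- <-; exact: m_leU.
  (* The [x] cancels: [y *# g] is [(x - w xi) - (x - w eta)]. *)
  have yg : (m (y *# g) <= U `|` V)%O.
    apply: le_trans (_ : m (x - w xi) `|` m (x - w eta) <= _)%O.
      apply: m_leU; rewrite -(labsN (x - w eta)); apply: le_trans (labsD _ _).
      by rewrite opprB addrC subrKA /g lmulDr lmulN.
    by rewrite leUx !xw.
  have gb : (lp (Gchain_in L Fab_b) <= m g)%O.
    apply: (Gchain_gap xe Fab_b_ge0); rewrite -!(e_spec _).2.
    apply: m_leU; apply: le_trans (labsD _ _).
    by rewrite /g subrK.
  have bUV : (m y <= U `|` V)%O.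
    by apply: le_trans yg; apply: le_trans (m_leM _ _); rewrite lexI lexx my.
  have aUV : (m x <= U `|` V)%O.
    apply: le_trans (_ : m (p xi) `|` m (w xi) <= _)%O.
      apply: m_leU; rewrite !labs_id// -{1}(subrK (x /|\ w xi) x).
      by rewrite pog_leD2l lmeet_ler.
    by rewrite pu mw leUx bUV leUl.
  (* Disjoint elements of an f-ring have product 0, so the meet of the images of [p xi] and [q xi]
     lies below [m 0]. *)
  have UV0 : (U `&` V <= lp 0)%O.
    rewrite -pu -qv; apply: le_trans (m_leM _ _) _.
    by rewrite lmul_disj0.
  have in0 (t : Fab) : 0 <= t -> 0 <= Gchain_in L t.
    by move=> t0; rewrite Gchain_in_ge0.
  have [k uk] : exists k, u <= Fab_a *+ k.
    by apply: (Gchain_in_bounded u0 Fab_a_ge0 (L := L)); have := px xi; rewrite pu mx.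
  have [l vl] : exists l, v <= Fab_b *+ l.
    by apply: (Gchain_in_bounded v0 Fab_b_ge0 (L := L)); have := qy xi; rewrite qv my.
  have [n abn] : exists n, Fab_a + Fab_b <= (u + v) *+ n.
    have ab0 := pog_addr_ge0 Fab_a_ge0 Fab_b_ge0.
    apply: (Gchain_in_bounded ab0 (pog_addr_ge0 u0 v0) (L := L)).
    have UVle : (U `|` V <= lp (Gchain_in L (u + v)))%O.
      by rewrite Gchain_inD; exact: lpU_le (in0 _ u0) (in0 _ v0).
    apply: le_trans UVle.
    apply/lp_le; have IK := Idlc_lideal (U `|` V)%O.
    rewrite Gchain_inD.
    by apply: (is_lidealD IK); apply/lp_le; [rewrite -mx|rewrite -my].
  apply: (@Fab_connected u v k l n) => //.
  apply/le_anti; rewrite lmeet_ge0// andbT -(Gchain_in_le L).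
  have uv_le : Gchain_in L (u /|\ v) <= Gchain_in L u /|\ Gchain_in L v.
    by rewrite le_lmeet !Gchain_in_le lmeet_lel lmeet_ler.
  by rewrite (lpI_eq0 (in0 _ u0) (in0 _ v0) UV0) in uv_le.
apply/countable_injP.
exists (fun xi => pickle (Fab_code (f xi).1, Fab_code (f xi).2)).
move=> xi eta _ _ /(pcan_inj pickleK)[/Fab_code_inj f1 /Fab_code_inj f2].
have fE : f xi = f eta by rewrite [LHS]surjective_pairing f1 f2 -surjective_pairing.
by case: (ltgtP xi eta) => // /f_neq h; case: h.
Qed.

End Surjection.

Theorem theorem6p4 :
  ~ (exists (A : comFringType)
            (mu : {lmorphism Idrc A -> Idlc (Gchain (omega1^d))}),
       forall J : Idlc (Gchain (omega1^d)), exists I : Idrc A, mu I = J).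
Proof.
(* Countability ignores the order, so it passes from [omega1^d] to [omega1]. *)
by move=> [A [mu /countable_of_surjection/omega1_uncountable]].
Qed.
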